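(* Let $(X_t,J_t)$ be a spectrally positive Markov additive process with background state space $\{1,\ldots,d\}$ satisfying the stability condition $$-\sum_{i=1}^d\pi_i\varphi_i'(0)+\sum_{i=1}^d\sum_{j\neq i}\pi_i q_{ij}\,\mathbb{E}\,U_{ij}<0,$$ and let $(Q_t)_{t\geqslant 0}$ be the associated stationary workload process, with $\mathrm{Var}(Q_0)<\infty$. Let $\vartheta>0$, and suppose that there are complex numbers $c_{ij}(\vartheta)$ and $\psi_j(\vartheta)$, $i,j\in\{1,\ldots,d\}$, with $\mathrm{Re}\,\psi_j(\vartheta)>0$, such that $$\mathbb{E}_i\,e^{-\vartheta\tau(y)}=\sum_{j=1}^d c_{ij}(\vartheta)\,e^{-\psi_j(\vartheta)\,y}\qquad\text{for all } y>0,\ i\in\{1,\ldots,d\}.$$ Let $T$ be exponentially distributed with mean $\vartheta^{-1}$, independent of everything else, and put $\gamma(\vartheta):=\mathrm{Cov}(Q_0,Q_T)$. Then $$\gamma(\vartheta)=\kappa''(0)-(\kappa'(0))^2-\sum_{i=1}^d\sum_{j=1}^d\frac{c_{ij}(\vartheta)}{\psi_j(\vartheta)}\,\kappa_i'(\psi_j(\vartheta))-\sum_{i=1}^d\nu_i(\vartheta)\,\kappa_i'(0).$$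
   Context: Markov additive process: $(J_t)$ is an irreducible continuous-time Markov chain on $\{1,\ldots,d\}$ with transition rate matrix $(q_{ij})$ and stationary distribution $\boldsymbol\pi=(\pi_1,\ldots,\pi_d)$. For each $i$, $X^{(i)}$ is a Lévy process; while $J_t=i$, $X_t$ evolves with the increments of $X^{(i)}$, and when $J$ jumps from $i$ to $j\ne i$, $X$ makes an additional jump distributed as $U_{ij}$ (all Lévy processes, jumps, and $J$ being independent, jumps for the same $(i,j)$ being i.i.d.); $X_0=0$. Spectrally positive: all $X^{(i)}$ have only upward jumps, with Laplace exponent $\varphi_i(\alpha)=\log\mathbb{E}\,e^{-\alpha X_1^{(i)}}$, and $U_{ij}\geqslant 0$ almost surely; $\varphi_i'(0)$ is the right derivative at $0$. Workload: $Q_t=X_t+\max\{Q_0,-\inf_{0\leqslant u\leqslant t}X_u\}$ for $t\geqslant 0$, where $(Q_0,J_0)$ has the stationary distribution of the Markov process $(Q_t,J_t)$ and, given $J_0$, $Q_0$ is independent of $(X_t,J_t)_{t\geqslant 0}$. Notation: $\mathbb{E}_i(\cdot)=\mathbb{E}(\cdot\mid J_0=i)$; $\tau(y)=\inf\{t\geqslant 0:X_t\leqslant -y\}$ (with $e^{-\vartheta\cdot\infty}=0$); $\nu_i(\vartheta)=\mathbb{E}_iX_T$; $\kappa(\alpha)=\mathbb{E}\,e^{-\alpha Q_0}$; $\kappa_i(\alpha)=\mathbb{E}(e^{-\alpha Q_0}1_{\{J_0=i\}})$ for $\mathrm{Re}\,\alpha\geqslant 0$; derivatives at $0$ are one-sided.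 *)

(* Defs.v *)
(* Markov additive processes and their workload, over MathComp-Analysis
   (complex numbers R[i] from mathcomp-real-closed).

   Conventions.
   - Time-indexed families are functions on R; only times t >= 0 are ever
     constrained or used.
   - The processes X and X^(i) start at 0, and X, X^(i), J have cadlag paths for
     every outcome; the other path properties hold almost surely. *)
From HB Require Import structures.
From mathcomp Require Import all_boot all_order all_algebra.
From mathcomp Require Import finmap.
From mathcomp Require Import all_classical all_reals all_analysis.
From mathcomp.real_closed Require Import complex.

Set Implicit Arguments.
Unset Strict Implicit.
Unset Printing Implicit Defensive.

Import Order.TTheory GRing.Theory Num.Theory.
Import numFieldNormedType.Exports.

Local Open Scope classical_set_scope.
Local Open Scope complex_scope.
Local Open Scope ring_scope.

Section independence.
Context (dd : measure_display) (Omega : measurableType dd) (R : realType).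
Variable P : probability Omega R.

(* Mutual independence of the classes of events G k, for k in D: the product
   rule over every finite subfamily. *)
Definition mutually_independent (I : Type) (D : set I)
    (G : I -> set (set Omega)) : Prop :=
  forall (n : nat) (k : 'I_n -> I) (A : 'I_n -> set Omega),
    injective k ->
    (forall m, D (k m)) -> (forall m, G (k m) (A m)) ->
    P (\bigcap_(m in [set: 'I_n]) A m) = (\prod_(m < n) P (A m))%E.

Definition independent_classes (F G : set (set Omega)) : Prop :=
  forall A B, F A -> G B -> P (A `&` B) = (P A * P B)%E.

Definition sigma_var (Z : Omega -> R) : set (set Omega) :=
  preimage_set_system setT Z measurable.

Definition sigma_process (Y : R -> Omega -> R) : set (set Omega) :=
  <<s \bigcup_(t in [set t : R | 0 <= t]) sigma_var (Y t) >>.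

(* The finite state space 'I_d carries the discrete sigma-algebra. *)
Definition sigma_chain (d : nat) (J : R -> Omega -> 'I_d) : set (set Omega) :=
  <<s \bigcup_(t in [set t : R | 0 <= t])
        preimage_set_system setT (J t) [set: set 'I_d] >>.

End independence.

Section expectations.
Context (dd : measure_display) (Omega : measurableType dd) (R : realType).
Variable P : probability Omega R.

(* E (f | A) for an event A of positive probability. *)
Definition cond_expectation (A : set Omega) (f : Omega -> R) : R :=
  fine (\int[P]_(w in A) (f w)%:E)%E / fine (P A).

Definition Cexpectation (f : Omega -> R[i]) : R[i] :=
  fine ('E_P[fun w => complex.Re (f w)])%E
    +i* fine ('E_P[fun w => complex.Im (f w)])%E.

End expectations.

Definition Cexp (R : realType) (z : R[i]) : R[i] :=
  (expR (complex.Re z) * cos (complex.Im z))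
    +i* (expR (complex.Re z) * sin (complex.Im z)).

(* Derivative of a function on the closed right half-plane, relative to that
   domain: the ordinary complex derivative when Re a > 0, the one-sided
   derivative at a = 0. *)
Definition deriv_half_plane (R : realType) (f : R[i] -> R[i]) (a : R[i]) : R[i] :=
  lim ((fun z : R[i]^o => (f z - f a) / (z - a) : R[i]^o)
       @ within [set z : R[i]^o | 0 <= complex.Re z] (a : R[i]^o)^').

(* Right derivative at 0, in [-oo, +oo]. *)
Definition right_derivative0 (R : realType) (f : R -> R) : \bar R :=
  lim (((f h - f 0) / h)%:E @[h --> (0 : R)^'+]).

Definition cadlag (R : realType) (x : R -> R) : Prop :=
  (forall t : R, 0 <= t -> x s @[s --> t^'+] --> x t) /\
  (forall t : R, 0 < t -> cvg (x s @[s --> t^'-])).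

(* Cadlag for the discrete topology on the state space. *)
Definition cadlag_chain (R : realType) (d : nat) (x : R -> 'I_d) : Prop :=
  (forall t : R, 0 <= t -> \forall s \near t^'+, x s = x t) /\
  (forall t : R, 0 < t -> exists i, \forall s \near t^'-, x s = i).

Section markov_chain.
Context (R : realType) (d : nat).

(* q is the rate matrix of the standard transition function p. *)
Record transition_function (q : 'M[R]_d) (p : R -> 'M[R]_d) : Prop := {
  tf_ge0 : forall (t : R) i j, 0 <= t -> 0 <= p t i j;
  tf_sum1 : forall (t : R) i, 0 <= t -> \sum_j p t i j = 1;
  tf_zero : p 0 = 1%:M;
  tf_semigroup : forall s t : R, 0 <= s -> 0 <= t -> p (s + t) = p s *m p t;
  tf_rate : forall i j,
    (p h i j - (i == j)%:R) / h @[h --> (0 : R)^'+] --> q i j }.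

Definition irreducible_rates (q : 'M[R]_d) : Prop :=
  forall i j, connect (fun k l => 0 < q k l) i j.

Definition stationary_distribution (q : 'M[R]_d) (pi : 'rV[R]_d) : Prop :=
  [/\ forall i, 0 <= pi ord0 i, \sum_i pi ord0 i = 1 & pi *m q = 0].

Context (dd : measure_display) (Omega : measurableType dd).
Variable P : probability Omega R.

Record markov_chain (q : 'M[R]_d) (J : R -> Omega -> 'I_d) : Prop := {
  mc_measurable : forall (t : R) i, 0 <= t -> measurable [set w | J t w = i];
  mc_cadlag : forall w, cadlag_chain (fun t => J t w);
  mc_markov : exists2 p, transition_function q p &
    forall (n : nat) (t : nat -> R) (s : nat -> 'I_d),
      t 0%N = 0 -> {homo t : k l / (k <= l)%N >-> k <= l} ->
      P [set w | forall k, (k <= n)%N -> J (t k) w = s k] =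
      (P [set w | J 0%R w = s 0%N] *
       (\prod_(k < n) p (t k.+1 - t k) (s k) (s k.+1))%:E)%E }.

Definition transition_at (x : R -> 'I_d) (i j : 'I_d) (t : R) : Prop :=
  [/\ 0 < t, x t = j & \forall s \near t^'-, x s = i].

(* Number of transitions from i to j during (0, t); finitely many for a cadlag
   path when i != j. *)
Definition transitions_before (x : R -> 'I_d) (i j : 'I_d) (t : R) : nat :=
  #|` fset_set [set u | u < t /\ transition_at x i j u]|%fset.

End markov_chain.

Section levy.
Context (dd : measure_display) (Omega : measurableType dd) (R : realType).
Variable P : probability Omega R.

Record levy_process (Y : R -> Omega -> R) : Prop := {
  levy_measurable : forall t : R, 0 <= t -> measurable_fun setT (Y t);
  levy_zero : forall w, Y 0 w = 0;
  levy_cadlag : forall w, cadlag (fun t => Y t w);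
  levy_stationary : forall (s h : R) (B : set R), 0 <= s -> 0 <= h -> measurable B ->
    P [set w | B (Y (s + h) w - Y s w)] = P [set w | B (Y h w)];
  levy_independent : forall (n : nat) (t : nat -> R),
    0 <= t 0%N -> {homo t : k l / (k <= l)%N >-> k <= l} ->
    mutually_independent P [set: 'I_n]
      (fun k => sigma_var (fun w => Y (t k.+1) w - Y (t k) w)) }.

Definition no_downward_jumps (Y : R -> Omega -> R) : Prop :=
  {ae P, forall w, forall (t l : R), 0 < t ->
    Y s w @[s --> t^'-] --> l -> l <= Y t w}.

(* On alpha >= 0, where E exp(- alpha Y_1) is finite when Y is spectrally
   positive. *)
Definition laplace_exponent (Y : R -> Omega -> R) (alpha : R) : R :=
  ln (fine ('E_P[fun w => (expR (- alpha * Y 1 w))%R])%E).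

End levy.

(* The independent ingredients of a Markov additive process: the Levy process
   of state i, the additional jump at the (n+1)-st transition from i to j, and
   the background chain. *)
Inductive ingredient (d : nat) : Type :=
| Levy of 'I_d
| Jump of 'I_d & 'I_d & nat
| Background.
Arguments Background {d}.

Section map.
Context (dd : measure_display) (Omega : measurableType dd) (R : realType).
Variables (P : probability Omega R) (d : nat).
(* Y i is the Levy process X^(i); the U i j n (n >= 0) are copies of U_ij. *)
Variables (Y : 'I_d -> R -> Omega -> R) (U : 'I_d -> 'I_d -> nat -> Omega -> R).
Variables (X : R -> Omega -> R) (J : R -> Omega -> 'I_d).

Definition ingredients : set (ingredient d) :=
  [set k | if k is Jump i j _ then i <> j else True].

Definition sigma_ingredient (k : ingredient d) : set (set Omega) :=
  match k with
  | Levy i => sigma_process (Y i)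
  | Jump i j n => sigma_var (U i j n)
  | Background => sigma_chain J
  end.

(* The increment of X over [s, t] when J stays in i on [s, t], and when J stays
   in i on [s, t) and moves to j at time t. *)
Definition map_evolution (w : Omega) : Prop :=
  (forall (s t : R) i, 0 <= s -> s <= t ->
     (forall u, s <= u <= t -> J u w = i) ->
     X t w - X s w = Y i t w - Y i s w) /\
  (forall (s t : R) i j, 0 <= s -> s < t -> i <> j ->
     (forall u, s <= u < t -> J u w = i) -> J t w = j ->
     X t w - X s w = Y i t w - Y i s w +
       U i j (transitions_before (fun u => J u w) i j t) w).

Record spectrally_positive_map (q : 'M[R]_d) : Prop := {
  map_chain : markov_chain P q J;
  map_levy : forall i, levy_process P (Y i);
  map_jump_measurable : forall i j n, i <> j -> measurable_fun setT (U i j n);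
  map_jump_identical : forall i j n (B : set R), i <> j -> measurable B ->
    P (U i j n @^-1` B) = P (U i j 0%N @^-1` B);
  map_independent : mutually_independent P ingredients sigma_ingredient;
  map_measurable : forall t : R, 0 <= t -> measurable_fun setT (X t);
  map_cadlag : forall w, cadlag (fun t => X t w);
  map_zero : forall w, X 0 w = 0;
  map_evolves : {ae P, forall w, map_evolution w};
  map_levy_positive : forall i, no_downward_jumps P (Y i);
  map_jump_ge0 : forall i j n, i <> j -> {ae P, forall w, 0 <= U i j n w} }.

(* An inequality in [-oo, +oo]: a priori phi_i'(0) may be -oo and E U_ij may
   be +oo. *)
Definition stability_condition (q : 'M[R]_d) (pi : 'rV[R]_d) : Prop :=
  (- (\sum_(i < d) (pi ord0 i)%:E * right_derivative0 (laplace_exponent P (Y i)))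
   + \sum_(i < d) \sum_(j < d | j != i)
       (pi ord0 i * q i j)%:E * 'E_P[U i j 0%N] < 0)%E.

Definition sigma_map : set (set Omega) := <<s sigma_process X `|` sigma_chain J >>.

(* The formula for Q at t = 0 forces Q 0 >= 0. *)
Record stationary_workload (Q : R -> Omega -> R) : Prop := {
  workload_measurable : measurable_fun setT (Q 0);
  workload_formula : forall (t : R) w, 0 <= t ->
    Q t w = X t w + Num.max (Q 0 w) (- inf [set X u w | u in `[0, t]]);
  workload_stationary : forall (t : R) (B : set R) i, 0 <= t -> measurable B ->
    P [set w | B (Q t w) /\ J t w = i] = P [set w | B (Q 0 w) /\ J 0 w = i];
  workload_cond_independent : forall i A B, sigma_var (Q 0) A -> sigma_map B ->
    (P [set w | J 0%R w = i] * P (A `&` B `&` [set w | J 0%R w = i]) =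
     P (A `&` [set w | J 0%R w = i]) * P (B `&` [set w | J 0%R w = i]))%E }.

(* Everything but the sampling time. *)
Definition sigma_all (Q : R -> Omega -> R) : set (set Omega) :=
  <<s sigma_var (Q 0) `|` sigma_map `|`
      \bigcup_(k in ingredients) sigma_ingredient k >>.

Definition first_passage (y : R) (w : Omega) : \bar R :=
  ereal_inf [set t%:E | t in [set t : R | 0 <= t /\ X t w <= - y]].

(* E_i exp(- theta tau(y)). *)
Definition passage_transform (theta y : R) (i : 'I_d) : R :=
  cond_expectation P [set w | J 0 w = i]
    (fun w => fine (expeR (- (theta%:E * first_passage y w)))%E).

Definition nu (T : Omega -> R) (i : 'I_d) : R :=
  cond_expectation P [set w | J 0 w = i] (fun w => X (T w) w).

Definition kappa (Q : R -> Omega -> R) (alpha : R[i]) : R[i] :=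
  Cexpectation P (fun w => Cexp (- alpha * (Q 0 w)%:C)).

Definition kappa_state (Q : R -> Omega -> R) (i : 'I_d) (alpha : R[i]) : R[i] :=
  Cexpectation P (fun w => Cexp (- alpha * (Q 0 w)%:C) * (J 0 w == i)%:R).

End map.

(* T is a time, hence takes values in [0, +oo) for every outcome. *)
Definition exponentially_distributed (dd : measure_display)
    (Omega : measurableType dd) (R : realType) (P : probability Omega R)
    (rate : R) (T : Omega -> R) : Prop :=
  [/\ measurable_fun setT T, forall w, 0 <= T w &
      forall B : set R, measurable B -> P (T @^-1` B) = exponential_prob rate B].

(* Main.v *)
Require Import Defs.
From HB Require Import structures.
From mathcomp Require Import all_boot all_order all_algebra.
From mathcomp Require Import all_classical all_reals all_analysis.
From mathcomp.real_closed Require Import complex.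
From mathcomp Require Import measurable_realfun ring lra.
Set Implicit Arguments.
Unset Strict Implicit.
Unset Printing Implicit Defensive.
Import Order.TTheory GRing.Theory Num.Theory.
Import numFieldNormedType.Exports.
Local Open Scope classical_set_scope.
Local Open Scope complex_scope.
Local Open Scope ring_scope.

(* With M_t = - inf_{[0, t]} X one has Q_T = X_T + Q_0 + (M_T - Q_0)^+, hence
   Q_0 Q_T = Q_0^2 + Q_0 X_T + Q_0 (M_T - Q_0)^+.  Given J_0 = i, Q_0 is
   independent of (X_T, M_T), which turns the second term into the nu_i kappa_i'(0).
   For the third, P_i(M_T > y) = E_i exp(- theta tau(y)), a sum of exponentials in
   y, and integrating P_i(M_T > y) over y > Q_0 produces the terms
   c_ij / psi_j exp(- psi_j Q_0).  That (M_T - Q_0)^+ and Q_T, which has the law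
   of Q_0, are integrable enough gives the integrability of X_T. *)

(** [T] is independent of the events generated by the model, not of all measurable events of
    [Omega]. So [Omega] is also regarded as a second measurable space carrying only a generated
    sigma-algebra: the pair (T, w) then has a product law, and cadlag paths supply the joint
    measurability in time and outcome that Fubini requires. Freezing the time transports conditional
    independence and stationarity to [T]; freezing the path evaluates the exponential tail at
    tau(y).

    The passage time uses the closed condition X <= -y while M_T > y asks for X < -y somewhere,
    hence a squeeze between neighbouring levels. Identities conditional on J_0 = i are kept
    multiplied by P(J_0 = i), so that they keep their meaning when this vanishes.

    The c_ij and psi_j are complex although the sums they form are real. Complex identities are
    tested through Re (k z) with k = 1 and k = -i, which leaves only real integrals, and the sums of
    c_ij / psi_j exp(- psi_j x) have to be proved real. *)

(** * Running infimum of a cadlag path *)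

Section paths.
Context (R : realType).
Implicit Types x : R -> R.

(** Right continuity and left limits bound the path below near every point; compactness of [0, t]
    makes the bound uniform. *)
Lemma cadlag_has_lbound x (t : R) : cadlag x -> 0 <= t ->
  has_lbound [set x u | u in `[0, t]].
Proof.
move=> [xr xl] t0.
have bnd (F : set_system R) (FF : Filter F) (l : R) : x s @[s --> F] --> l ->
    \forall s \near F, l - 1 <= x s.
  move/cvgrPdist_lt => h; have := h 1 ltr01; apply: filterS => s.
  by rewrite ltr_norml => /andP[_]; lra.
have loc (u : R) : 0 <= u -> exists M : R, \forall s \near u, 0 <= s -> M <= x s.
  move=> u0; have hR := bnd _ _ _ (xr _ u0).
  have [M hL] : exists M : R, \forall s \near u^'-, 0 <= s -> M <= x s.
    (* At u = 0 there is no left limit, but points s < 0 fail the premise 0 <= s, so any bound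
       serves. *)
    have [->|un0] := eqVneq u 0.
      by exists 0; near=> s; rewrite leNgt => /negP; case; near: s; exact: nbhs_left_lt.
    have ugt0 : 0 < u by rewrite lt_neqAle eq_sym un0.
    have [l hl] : exists l : R, x s @[s --> u^'-] --> l by apply/cvg_ex; exact: xl.
    by exists (l - 1); apply: filterS (bnd _ _ _ hl) => s + _.
  exists (Num.min M (Num.min (x u) (x u - 1))).
  move: hR hL; rewrite !near_withinE => hR hL.
  near=> s => s0; rewrite !ge_min.
  have hR' : u < s -> x u - 1 <= x s by near: s; exact: hR.
  have hL' : s < u -> 0 <= s -> M <= x s by near: s; exact: hL.
  have [su|us|->] := ltgtP s u; last by rewrite lexx orbT.
  - by rewrite hL'.
  - by rewrite hR' ?orbT.
(* The covering is indexed by the bound M tending to +oo, so that finitely many local bounds merge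
   into one. *)
have /compact_near_coveringP/(_ R (+oo%R) (fun M u => 0 <= u -> - M <= x u)) :=
  @segment_compact R 0 t.
case => [u /=|M [_ /(_ (M + 1))]].
  rewrite in_itv/= => /andP[u0 _].
  have [M0 hM0] := loc _ u0.
  exists ([set s : R | 0 <= s -> M0 <= x s], [set M : R | - M0 <= M]).
    by split => //=; apply: nbhs_pinfty_ge; exact: num_real.
  by move=> [s M] /= [h1 h2] s0; apply: le_trans (h1 s0); rewrite lerNl.
rewrite ltrDl ltr01 => /(_ isT) hM.
exists (- (M + 1)) => _ /= [u ut <-]; apply: hM => //.
by move: ut; rewrite /= in_itv/= => /andP[].
Unshelve. all: by end_near. Qed.

(** The lower bound is what makes [inf] a genuine infimum here: on a set unbounded below it would be
    a default value. *)
Lemma running_inf_lt x (t y : R) : cadlag x -> 0 <= t ->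
  y < - inf [set x u | u in `[0, t]] <-> exists2 u, 0 <= u <= t & x u < - y.
Proof.
move=> cx t0; rewrite ltrNr; split.
  move=> /inf_lt[|_ /= [u ut <-] uy]; last by exists u => //; rewrite in_itv/= in ut.
  by exists (x t), t => //=; rewrite in_itv/= t0 lexx.
move=> [u ut uy]; apply: le_lt_trans uy; apply: ge_inf.
  exact: cadlag_has_lbound.
by exists u => //=; rewrite in_itv.
Qed.

(** Right continuity moves a crossing time u < t to a rational slightly to its right. The end point
    t has no such neighbour inside [0, t] and stays a separate case. The crossing event becomes a
    countable union. *)
Lemma running_inf_lt_rat x (t y : R) : cadlag x -> 0 <= t ->
  y < - inf [set x u | u in `[0, t]] <->
  x t < - y \/ exists r : rat, 0 <= (ratr r : R) < t /\ x (ratr r) < - y.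
Proof.
move=> cx t0; rewrite running_inf_lt//; split; last first.
  case=> [ht|[r [/andP[r0 rt] hr]]]; first by exists t; rewrite ?t0 ?lexx.
  by exists (ratr r) => //; rewrite r0 ltW.
move=> [u /andP[u0]]; rewrite le_eqVlt => /predU1P[->|ut] uy; first by left.
right; case: cx => /(_ u u0)/cvgrPdist_lt h _.
have /h : 0 < - y - x u by lra.
rewrite near_withinE => /nbhs_ballP[e /= e0 he].
have /rat_in_itvoo[r] : u < Num.min t (u + e) by rewrite lt_min ut; lra.
rewrite in_itv/= lt_min => /and3P[ur rt rue]; exists r.
rewrite rt (le_trans u0 (ltW ur)); split => //.
have rball : ball u e (ratr r : R).
  by rewrite /ball/= ltr_norml; apply/andP; split; lra.
by have := he _ rball ur; rewrite ltr_norml => /andP[]; lra.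
Qed.

End paths.

(** * Joint measurability in time and outcome *)

Section joint_measurability.
Context (R : realType) (d : measure_display) (S : measurableType d).
Variable X : R -> S -> R.
Hypothesis mX : forall t, 0 <= t -> measurable_fun setT (X t).
Hypothesis cX : forall w, cadlag (X ^~ w).

(** The least multiple of 1/(n+1) strictly above t. Strictness matters: convergence to t is then
    from the right, where a cadlag path has limit its value at t. *)
Let grid (n : nat) (t : R) : R := (Num.trunc (t * n.+1%:R)).+1%:R / n.+1%:R.

Let grid_gt n t : 0 <= t -> t < grid n t.
Proof.
move=> t0; rewrite /grid ltr_pdivlMr//.
by have /truncn_itv/andP[] : 0 <= t * n.+1%:R by rewrite mulr_ge0.
Qed.

Let grid_le n t : 0 <= t -> grid n t <= t + n.+1%:R^-1.
Proof.
move=> t0; rewrite /grid ler_pdivrMr// mulrDl mulVf// -natr1 lerD2r.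
by have /truncn_itv/andP[] : 0 <= t * n.+1%:R by rewrite mulr_ge0.
Qed.

(** The process is the pointwise limit of its values at grid times, and each approximant is
    piecewise a process at a fixed time. [Num.max p.1 0] confines attention to nonnegative times,
    the only constrained ones. *)
Lemma measurable_cadlag_process :
  measurable_fun setT (fun p : R * S => X (Num.max p.1 0) p.2).
Proof.
have mm : measurable_fun setT (fun p : R * S => Num.max p.1 0).
  by apply: measurable_maxr => //; exact: measurable_fst.
apply: (measurable_fun_cvg
  (h := fun n (p : R * S) => X (grid n (Num.max p.1 0)) p.2)) => //.
- move=> n.
  (* The strip of times whose grid point is (k+1)/(n+1). *)
  pose E k : set (R * S) :=
    [set p | k%:R <= Num.max p.1 0 * n.+1%:R < k.+1%:R].
  have mE k : measurable (E k).
    rewrite -[E k]setTI.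
    have : measurable_fun setT (fun p : R * S => Num.max p.1 0 * n.+1%:R).
      exact: measurable_funM.
    move=> /(_ measurableT `[k%:R, k.+1%:R[%classic (measurable_itv _)).
    by congr (measurable (_ `&` _)); apply/seteqP; split => p /=; rewrite in_itv.
  have -> : [set: R * S] = \bigcup_k E k.
    apply/seteqP; split => // p _; exists (Num.trunc (Num.max p.1 0 * n.+1%:R)) => //.
    by rewrite /E/=; apply: truncn_itv; rewrite mulr_ge0// le_max lexx orbT.
  apply/measurable_fun_bigcup => // k.
  apply: (@eq_measurable_fun _ _ _ _ _ (fun p : R * S => X (k.+1%:R / n.+1%:R) p.2)).
    by move=> p; rewrite inE /E/= => /truncn_def hk; rewrite /grid hk.
  apply: measurable_funTS; apply: measurableT_comp measurable_snd.
  by apply: mX; rewrite divr_ge0.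
- move=> p _.
  set t := Num.max p.1 0; have t0 : 0 <= t by rewrite le_max lexx orbT.
  case: (cX p.2) => /(_ t t0) h _.
  apply: (cvg_comp _ _ _ h).
  move=> A; rewrite /= => /nbhs_ballP[e /= e0 eA].
  near=> n; apply: eA; last exact: grid_gt.
  rewrite /ball/= distrC ger0_norm ?subr_ge0 ?(ltW (grid_gt _ _))//.
  rewrite ltrBlDl (le_lt_trans (grid_le _ _))// ltrD2l.
  by near: n; exact: near_infty_natSinv_lt (PosNum e0).
Unshelve. all: by end_near. Qed.

(** Rays ]y, +oo[ generate the Borel sets, and [running_inf_lt_rat] writes their preimages with
    countably many times. *)
Lemma measurable_running_sup :
  measurable_fun setT (fun p : R * S =>
    - inf [set X u p.2 | u in `[0, Num.max p.1 0]]).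
Proof.
have t0 (p : R * S) : 0 <= Num.max p.1 0 by rewrite le_max lexx orbT.
apply: (@measurability _ _ _ _ _ _ _ (RGenOInfty.measurableE R)) => //.
move=> _ [_ [y ->] <-]; rewrite setTI.
have mX' := measurable_cadlag_process.
rewrite (_ : _ @^-1` _ = (fun p : R * S => X (Num.max p.1 0) p.2) @^-1` `]-oo, (- y)[
    `|` \bigcup_(r : rat) (if 0 <= (ratr r : R) then
       `](ratr r), +oo[ `*` X (ratr r) @^-1` `]-oo, (- y)[ else set0)); last first.
  apply/seteqP; split => p /=; rewrite !in_itv/= ?andbT.
    move/(running_inf_lt_rat _ (cX p.2) (t0 p)) => [|[r [/andP[r0 rt] Xr]]]; first by left.
    right; exists r => //=; rewrite r0; split => //=; rewrite ?in_itv/= ?andbT//.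
    by move: rt; rewrite lt_max [ratr r < 0]ltNge r0 orbF.
  move=> h; apply/(running_inf_lt_rat _ (cX p.2) (t0 p)).
  case: h => [h|[r _]]; first by left.
  case: ifPn => // r0; rewrite /= ?in_itv/= ?andbT => -[rp Xr]; right; exists r.
  by rewrite r0 lt_max rp.
apply: measurableU.
  by rewrite -[X in measurable X]setTI; exact: mX'.
apply: bigcupT_measurable_rat => r; case: ifPn => // r0; apply: measurableX => //.
by rewrite -[X in measurable X]setTI; exact: mX.
Qed.

End joint_measurability.

(** * Sampling at an independent time *)

Section independent_time.
Context (R : realType) (dd : measure_display) (Omega : measurableType dd).
Variable P : probability Omega R.
Variables (T : Omega -> R) (G : set (set Omega)).
Hypothesis mT : measurable_fun setT T.
Hypothesis mG : <<s G>> `<=` measurable.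
Hypothesis TG : independent_classes P (sigma_var T) <<s G>>.

(** The sample space with the smaller sigma-algebra: the identity into it is a random element
    independent of [T]. *)
Let S := g_sigma_algebraType G.

Let mid : measurable_fun setT (id : Omega -> S).
Proof. by move=> _ A mA; rewrite setTI; exact: mG. Qed.

Let mTid : measurable_fun setT (fun w : Omega => (T w, w : S)).
Proof. exact: measurable_fun_pair. Qed.

Let T' : {mfun Omega >-> R} := HB.pack T (isMeasurableFun.Build _ _ _ _ _ mT).
Let id' : {mfun Omega >-> S} :=
  HB.pack (id : Omega -> S) (isMeasurableFun.Build _ _ _ _ _ mid).
Let Tid' : {mfun Omega >-> (R * S)%type} :=
  HB.pack (fun w : Omega => (T w, w : S)) (isMeasurableFun.Build _ _ _ _ _ mTid).

(** Independence is the product rule on rectangles, and rectangles determine the product measure. *)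
Lemma law_independent_time (D : set (R * S)) : measurable D ->
  (distribution P T' \x distribution P id')%E D = distribution P Tid' D.
Proof.
apply: product_measure_unique => A B mA mB.
rewrite -[LHS]/(P (T @^-1` A `&` B)); apply: TG => //.
by exists A => //; rewrite setTI.
Qed.

(** Freezes the time: facts valid at each deterministic time pass to [T]. *)
Lemma independent_time_fubini1 (D : set (R * S)) : measurable D ->
  P [set w | D (T w, w)] = (\int[P]_v P [set w | D (T v, w)])%E.
Proof.
move=> mD; rewrite -[LHS]/(distribution P Tid' D) -law_independent_time//.
rewrite /product_measure1 ge0_integral_distribution//; last first.
  exact: measurable_fun_xsection.
by apply: eq_integral => w _ /=; congr (P _); apply/seteqP; split => v;
  rewrite /= /xsection/= inE.
Qed.

(** Freezes the path: what remains is the law of [T] on a set of times determined by that path. *)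
Lemma independent_time_fubini2 (D : set (R * S)) : measurable D ->
  P [set w | D (T w, w)] = (\int[P]_w P [set v | D (T v, w)])%E.
Proof.
move=> mD; rewrite -[LHS]/(distribution P Tid' D) -law_independent_time//.
transitivity ((distribution P T' \x^ distribution P id')%E D).
  by apply: product_measure_unique => // A B mA mB; exact: product_measure2E.
rewrite /product_measure2 ge0_integral_distribution//; last first.
  exact: measurable_fun_ysection.
by apply: eq_integral => w _ /=; congr (P _); apply/seteqP; split => v;
  rewrite /= /ysection/= inE.
Qed.

Lemma measurable_independent_time (D : set (R * S)) : measurable D ->
  measurable [set w | D (T w, w)].
Proof. by move=> mD; rewrite -[X in measurable X]setTI; exact: mTid. Qed.

Lemma measurable_fun_time_xsection (D : set (R * S)) : measurable D ->
  measurable_fun setT (fun v : Omega => P [set w | D (T v, w)]).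
Proof.
move=> mD.
rewrite (_ : (fun _ => _) = (distribution P id' \o xsection D) \o T'); last first.
  by apply/funext => v /=; congr (P _); apply/seteqP; split => w;
    rewrite /= /xsection/= inE.
by apply: measurableT_comp => //; exact: measurable_fun_xsection.
Qed.

Lemma measurable_fun_time_ysection (D : set (R * S)) : measurable D ->
  measurable_fun setT (fun w : Omega => P [set v | D (T v, w)]).
Proof.
move=> mD.
rewrite (_ : (fun _ => _) = (distribution P T' \o ysection D) \o id'); last first.
  by apply/funext => w /=; congr (P _); apply/seteqP; split => v;
    rewrite /= /ysection/= inE.
by apply: measurableT_comp => //; exact: measurable_fun_ysection.
Qed.

End independent_time.

(** * Conditional independence and expectations of products *)

Section conditional_product.
Context (R : realType) (dd : measure_display) (Omega : measurableType dd).
Variable P : probability Omega R.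
Variables (D : set Omega) (Z W : Omega -> R).
Hypothesis mD : measurable D.
Hypotheses (mZ : measurable_fun setT Z) (mW : measurable_fun setT W).
Hypothesis ZW : forall A B, measurable A -> measurable B ->
  (P D * P (Z @^-1` A `&` W @^-1` B `&` D) =
   P (Z @^-1` A `&` D) * P (W @^-1` B `&` D))%E.

(** Under P( . | D) the joint law of [Z] and [W] is a product, and Tonelli factors the integral.
    Multiplying through by P D instead of dividing keeps the identity valid on a null event, where
    both sides vanish. *)
Lemma conditional_product_integral (f g : R -> R) :
  measurable_fun setT f -> measurable_fun setT g ->
  (forall x, 0 <= f x) -> (forall x, 0 <= g x) ->
  (P D * \int[P]_(w in D) (f (Z w) * g (W w))%:E =
   \int[P]_(w in D) (f (Z w))%:E * \int[P]_(w in D) (g (W w))%:E)%E.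
Proof.
move=> mf mg f0 g0.
have mfZ : measurable_fun setT (f \o Z) by exact: measurableT_comp.
have mgW : measurable_fun setT (g \o W) by exact: measurableT_comp.
have mf' : measurable_fun setT (EFin \o f) by apply/measurable_EFinP.
have mg' : measurable_fun setT (EFin \o g) by apply/measurable_EFinP.
have f0' x : (0 <= (EFin \o f) x)%E by rewrite lee_fin.
have g0' x : (0 <= (EFin \o g) x)%E by rewrite lee_fin.
have [PD0|PD0] := eqVneq (P D) 0%E.
  rewrite PD0 mul0e (null_set_integral (mu:=P) mD _ PD0) ?mul0e//.
  by apply/measurable_EFinP; exact: measurable_funTS.
have PDfin : P D \is a fin_num by exact: fin_num_measure.
set p := fine (P D).
have pE : P D = p%:E by rewrite fineK.
have p0 : 0 < p by rewrite -lte_fin -pE lt_neqAle eq_sym PD0 measure_ge0.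
have pV0 : 0 <= p^-1 by rewrite invr_ge0 ltW.
(* P( . | D); the last argument is the fallback measure for mass zero, a case already excluded. *)
pose Pi := mnormalize (mrestr P mD) P.
have PiE A : Pi A = (P (A `&` D) * (p^-1)%:E)%E.
  by rewrite /Pi /mnormalize/= /mrestr setTI (negbTE PD0) pE/=.
have intE (h : Omega -> R) : measurable_fun setT h -> (forall w, 0 <= h w) ->
    (\int[P]_(w in D) (h w)%:E = p%:E * \int[Pi]_w (h w)%:E)%E.
  move=> mh h0.
  have mhE : measurable_fun setT (EFin \o h) by apply/measurable_EFinP.
  have -> : (\int[Pi]_w (h w)%:E = \int[Pi]_(w in D) (h w)%:E)%E.
    rewrite -[in RHS](setCK D) -setTD; apply: ge0_negligible_integral => //.
    - exact: measurableC.
    - by move=> w _; rewrite lee_fin.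
    - by apply: (etrans (PiE _)); rewrite setICl measure0 mul0e.
  rewrite (@eq_measure_integral _ _ _ _ (mscale (NngNum pV0) P) Pi); last first.
    by move=> A mA AD; apply: (etrans (PiE _)); rewrite setIidl// /mscale/= muleC.
  rewrite ge0_integral_mscale//; last 2 first.
  - exact: measurable_funTS mhE.
  - by move=> w _; rewrite lee_fin.
  by rewrite muleA -EFinM mulfV ?mul1e// gt_eqF.
pose Z' : {mfun Omega >-> R} := HB.pack Z (isMeasurableFun.Build _ _ _ _ _ mZ).
pose W' : {mfun Omega >-> R} := HB.pack W (isMeasurableFun.Build _ _ _ _ _ mW).
have mZW : measurable_fun setT (fun w => (Z w, W w)) by exact: measurable_fun_pair.
pose ZW' : {mfun Omega >-> (R * R)%type} :=
  HB.pack (fun w => (Z w, W w)) (isMeasurableFun.Build _ _ _ _ _ mZW).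
have mfg : measurable_fun setT (fun x : R * R => (f x.1 * g x.2)%:E).
  apply/measurable_EFinP; apply: measurable_funM.
    exact: measurableT_comp measurable_fst.
  exact: measurableT_comp measurable_snd.
have fg0 (x : R * R) : (0 <= (f x.1 * g x.2)%:E)%E by rewrite lee_fin mulr_ge0.
have key : (\int[Pi]_w (f (Z w) * g (W w))%:E =
    \int[Pi]_w (f (Z w))%:E * \int[Pi]_w (g (W w))%:E)%E.
  rewrite -[LHS](@ge0_integral_distribution _ _ _ _ _ Pi ZW' _ mfg fg0).
  rewrite (@eq_measure_integral _ _ _ _ (distribution Pi Z' \x distribution Pi W')%E); last first.
    move=> A mA _; apply/esym/product_measure_unique => // B C mB mC.
    rewrite -[LHS]/(Pi (Z @^-1` B `&` W @^-1` C)).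
    rewrite -[RHS]/(Pi (Z @^-1` B) * Pi (W @^-1` C))%E !PiE.
    rewrite muleACA -(ZW mB mC) pE muleAC -!EFinM mulrA mulfV ?gt_eqF// mul1r.
    by rewrite muleC.
  rewrite fubini_tonelli1//.
  rewrite -(@ge0_integral_distribution _ _ _ _ _ Pi Z' (EFin \o f) mf' f0').
  rewrite -(@ge0_integral_distribution _ _ _ _ _ Pi W' (EFin \o g) mg' g0').
  rewrite -ge0_integralZr//; last by apply: integral_ge0 => x _; exact: g0'.
  apply: eq_integral => x _; rewrite /fubini_F/=.
  under eq_integral do rewrite EFinM.
  by rewrite ge0_integralZl_EFin// => y _; exact: g0'.
rewrite pE (intE (fun w => f (Z w) * g (W w))); last 2 first.
  exact: measurable_funM.
  by move=> w; rewrite mulr_ge0.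
by rewrite (intE (fun w => f (Z w)))// (intE (fun w => g (W w)))// key [RHS]muleACA !muleA.
Qed.

End conditional_product.

(** * Real parts of the complex exponential *)

Section complex_exponential.
Context (R : realType).
Implicit Types (k u v z : R[i]) (s x : R).

Lemma Re_add u v : complex.Re (u + v) = complex.Re u + complex.Re v.
Proof. by case: u v => [? ?] [? ?]. Qed.

(** The reason for the multiplier [k] in all that follows: k = -i recovers imaginary parts from
    statements on real parts. *)
Lemma Im_Re z : complex.Im z = complex.Re (- 'i * z).
Proof. by case: z => a b /=; simpc; rewrite /=; ring. Qed.

Lemma abs_Re_le_normc z : `|complex.Re z| <= Normc.normc z.
Proof.
case: z => a b /=; rewrite -sqrtr_sqr ler_wsqrtr// lerDl sqr_ge0//.
Qed.

Lemma normc_ge0 z : 0 <= Normc.normc z.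
Proof. by case: z => a b; exact: sqrtr_ge0. Qed.

Lemma normcR x : Normc.normc x%:C = `|x|.
Proof. by rewrite /= expr0n/= addr0 sqrtr_sqr. Qed.

Lemma normc_le_ReIm z : Normc.normc z <= `|complex.Re z| + `|complex.Im z|.
Proof.
case: z => a b /=; rewrite -[leRHS]ger0_norm ?addr_ge0// -sqrtr_sqr ler_wsqrtr//.
by rewrite sqrrD !real_normK ?num_real// addrAC lerDl mulrn_wge0// mulr_ge0.
Qed.

Lemma normc_Cexp z : Normc.normc (Cexp z) = expR (complex.Re z).
Proof.
rewrite /Cexp /= !exprMn -mulrDr addrC sin2cos2 subrK mulr1 sqrtr_sqr ger0_norm//.
Qed.

Lemma abs_Re_Cexp_le k z : complex.Re z <= 0 ->
  `|complex.Re (k * Cexp z)| <= Normc.normc k.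
Proof.
move=> z0; apply: le_trans (abs_Re_le_normc _) _.
rewrite Normc.normcM normc_Cexp ler_piMr ?normc_ge0//.
by rewrite -expR0 ler_expR.
Qed.

Lemma is_derive_Re_Cexp k u v s :
  is_derive s 1 (fun s => complex.Re (k * Cexp (u + s%:C * v)))
    (complex.Re (k * v * Cexp (u + s%:C * v))).
Proof.
case: k u v => [k1 k2] [u1 u2] [v1 v2].
pose E s := expR (u1 + s * v1).
pose C s := cos (u2 + s * v2).
pose S s := sin (u2 + s * v2).
have dlin (a b : R) : is_derive s 1 (fun s => a + s * b) b.
  rewrite (_ : (fun s => _) = cst a + b \*: (id : R -> R)); last first.
    by apply/funext => r; rewrite !fctE /GRing.scale/= mulrC.
  by apply: is_derive_eq; rewrite add0r /GRing.scale/= mulr1.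
have dE : is_derive s 1 E (E s * v1) by apply: is_derive1_comp (dlin u1 v1).
have dC : is_derive s 1 C (- S s * v2) by apply: is_derive1_comp (dlin u2 v2).
have dS : is_derive s 1 S (C s * v2) by apply: is_derive1_comp (dlin u2 v2).
have := is_deriveB (is_deriveZ k1 (is_deriveM dE dC)) (is_deriveZ k2 (is_deriveM dE dS)).
congr (is_derive _ _ _ _).
  apply/funext => r; rewrite /Cexp; simpc => /=.
  by rewrite !fctE /GRing.scale/= /E /C /S.
rewrite /Cexp; simpc => /=; rewrite /GRing.scale/=.
rewrite -/(E s) -/(C s) -/(S s); ring.
Qed.

(** Mean value theorem for s -> Re (k exp(u + s v)) on [0, 1], where the segment stays in the left
    half-plane and the exponential has modulus at most 1. One application turns the remainder into
    an increment of the derivative, bounded by 2 |k| |v|; a second one gives |k| |v|^2. The linear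
    bound serves for domination, the quadratic one for convergence to 0. *)
Lemma Re_Cexp_taylor k u v : complex.Re u <= 0 -> complex.Re (u + v) <= 0 ->
  `|complex.Re (k * (Cexp (u + v) - Cexp u - v * Cexp u))| <=
    Normc.normc k * Num.min (2 * Normc.normc v) (Normc.normc v ^+ 2).
Proof.
move=> u0 uv0.
pose f k s := complex.Re (k * Cexp (u + s%:C * v)).
have df k' s : is_derive s 1 (f k') (f (k' * v) s) by exact: is_derive_Re_Cexp.
have cf k' : continuous (f k').
  by move=> s; apply/differentiable_continuous/derivable1_diffP; have [] := df k' s.
have fle k' s : 0 <= s <= 1 -> `|f k' s| <= Normc.normc k'.
  move=> /andP[s0 s1]; apply: abs_Re_Cexp_le.
  have -> : complex.Re (u + s%:C * v) = (1 - s) * complex.Re u + s * complex.Re (u + v).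
    by rewrite !Re_add; case: (u) (v) => [u1 u2] [v1 v2] /=; ring.
  by rewrite -oppr_ge0 opprD addr_ge0// -mulrN mulr_ge0 ?oppr_ge0 ?subr_ge0.
have [x x01 Dx] := @MVT_segment _ _ _ _ _ ler01 (fun s _ => df k s) (continuous_subspaceT (cf k)).
rewrite in_itv/= in x01; have /andP[x0 x1] := x01.
have [y y0x Dy] := @MVT_segment _ _ _ _ _ x0 (fun s _ => df (k * v) s) (continuous_subspaceT (cf (k * v))).
rewrite in_itv/= in y0x; have /andP[y0 yx] := y0x.
have -> : complex.Re (k * (Cexp (u + v) - Cexp u - v * Cexp u)) =
    f (k * v) x - f (k * v) 0.
  have -> : f (k * v) x = f k 1 - f k 0 by rewrite Dx subr0 mulr1.
  rewrite /f mul1r mul0r addr0 mulrBr mulrBr !Re_add mulrA.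
  by case: (k * Cexp u) (k * v * Cexp u) => [? ?] [].
rewrite minr_pMr ?normc_ge0// le_min; apply/andP; split.
  apply: le_trans (ler_normB _ _) _.
  rewrite mulrA [_ * 2]mulrC -mulrA -Normc.normcM mulr_natl mulr2n.
  by apply: lerD; apply: fle; rewrite ?x01// lexx ler01.
rewrite Dy subr0 normrM (ger0_norm x0).
rewrite expr2 mulrA -!Normc.normcM -[leRHS]mulr1; apply: ler_pM => //.
by apply: fle; rewrite y0 (le_trans yx).
Qed.

End complex_exponential.

(** An epsilon-delta criterion with real moduli. For [lim] to be the limit the filter must be
    proper: every point of the closed half-plane is approached from inside by moving it to the
    right. *)
Lemma deriv_half_plane_eq (R : realType) (f : R[i] -> R[i]) (a l : R[i]) :
  0 <= complex.Re a ->
  (forall e : R, 0 < e -> exists2 n : R, 0 < n & forall z : R[i],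
     0 <= complex.Re z -> z != a -> Normc.normc (z - a) <= n ->
     Normc.normc ((f z - f a) / (z - a) - l) <= e) ->
  deriv_half_plane f a = l.
Proof.
move=> a0 h; rewrite /deriv_half_plane; set D := [set _ | _].
have PF : ProperFilter (within D (a : R[i]^o)^').
  apply: Build_ProperFilter_ex => A.
  move=> /nbhs_ballP[[e i] /= e0 he].
  (* The radius is a complex number; being positive in the order of [R[i]] makes it real. *)
  have {e0} [/eqP i0 e0] : i == 0 /\ 0 < e by move: e0; rewrite ltcE/= => /andP[].
  subst i; pose z : R[i]^o := a + (e / 2)%:C.
  have h2 : 0 < e / 2 by rewrite divr_gt0.
  exists z; apply: he => /=.
  - rewrite /ball/= /z opprD addNKr normrN -[X in _ < X]/(e%:C).
    by rewrite -[X in X < _]/((Normc.normc (e / 2)%:C)%:C) normcR gtr0_norm// ltcR; lra.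
  - rewrite /z -subr_eq0 addrAC subrr add0r; apply/eqP => /(congr1 (@complex.Re R))/=.
    by move/eqP; rewrite gt_eqF.
  - by rewrite /D/= Re_add addr_ge0// ltW.
apply: (@cvg_lim (R[i]^o) (@norm_hausdorff R[i] R[i]^o) _ _ PF).
apply/cvgrPdist_le => -[e i] /= e0.
have {e0} [/eqP i0 e0] : i == 0 /\ 0 < e by move: e0; rewrite ltcE/= => /andP[].
subst i; have [n n0 hn] := h e e0.
apply/nbhs_ballP; exists n%:C; first by rewrite /= ltcR.
move=> z /= az za Dz.
rewrite distrC -[X in X <= _]/((Normc.normc _)%:C) -[X in _ <= X]/(e%:C) lecR.
apply: hn => //.
by move: az; rewrite /ball/= distrC -[X in X < _]/((Normc.normc _)%:C) ltcR => /ltW.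
Qed.

(** * Weighted Laplace transforms E (V exp(- z L)) *)

Section transform.
Context (R : realType) (dd : measure_display) (Omega : measurableType dd).
Variable P : probability Omega R.
Implicit Types (f g : Omega -> R) (k a z : R[i]).

Lemma le_integrable_fin f g : measurable_fun setT f ->
  (forall w, `|f w| <= g w) -> P.-integrable setT (EFin \o g) ->
  P.-integrable setT (EFin \o f).
Proof.
move=> mf fg; apply: le_integrable => //; first exact/measurable_EFinP.
by move=> w _ /=; rewrite lee_fin (le_trans (fg w))// ler_norm.
Qed.

Lemma integrable_finZl (x : R) f : P.-integrable setT (EFin \o f) ->
  P.-integrable setT (EFin \o (fun w => x * f w)).
Proof.
move=> /(integrableZl measurableT x); apply: eq_integrable => //.
Qed.

Lemma integrable_finD f g : P.-integrable setT (EFin \o f) ->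
  P.-integrable setT (EFin \o g) ->
  P.-integrable setT (EFin \o (fun w => f w + g w)).
Proof. exact: integrableD. Qed.

Lemma integrable_finB f g : P.-integrable setT (EFin \o f) ->
  P.-integrable setT (EFin \o g) ->
  P.-integrable setT (EFin \o (fun w => f w - g w)).
Proof. exact: integrableB. Qed.

Lemma integrable_fin_cst (x : R) : P.-integrable setT (EFin \o (fun=> x)).
Proof. exact: finite_measure_integrable_cst. Qed.

Lemma Cexpectation_transform (V L : Omega -> R) (z : R[i]) :
  Cexpectation P (fun w => (V w)%:C * Cexp (- z * (L w)%:C)) =
  (\int[P]_w (V w * complex.Re (1 * Cexp (- z * (L w)%:C))))
  +i* (\int[P]_w (V w * complex.Re (- 'i * Cexp (- z * (L w)%:C)))).
Proof.
rewrite /Cexpectation unlock; congr (fine _ +i* fine _); apply: eq_integral => w _.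
  by congr EFin; rewrite mul1r; case: (Cexp _) => [x y] /=; ring.
by congr EFin; rewrite -Im_Re; case: (Cexp _) => [x y] /=; ring.
Qed.

Lemma Re_mulN_real z (x : R) : complex.Re (- z * x%:C) = - (complex.Re z * x).
Proof. by case: z => z1 z2 /=; ring. Qed.

Variables (V L : Omega -> R).
Hypotheses (mV : measurable_fun setT V) (mL : measurable_fun setT L).
Hypothesis L0 : forall w, 0 <= L w.

Lemma measurable_Re_transform k z :
  measurable_fun setT (fun w => complex.Re (k * Cexp (- z * (L w)%:C))).
Proof.
rewrite (_ : (fun _ => _) = (fun s : R => complex.Re (k * Cexp (0 + s%:C * - z))) \o L).
  apply: measurableT_comp => //; apply: continuous_measurable_fun => s.
  apply/differentiable_continuous/derivable1_diffP.
  by have [] := is_derive_Re_Cexp k 0 (- z) s.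
by apply/funext => w /=; rewrite add0r [_%:C * _]mulrC.
Qed.

Lemma abs_Re_transform_le k z w : 0 <= complex.Re z ->
  `|complex.Re (k * Cexp (- z * (L w)%:C))| <= Normc.normc k.
Proof.
by move=> z0; apply: abs_Re_Cexp_le; rewrite Re_mulN_real oppr_le0 mulr_ge0.
Qed.

Lemma integrable_Re_transform k z : 0 <= complex.Re z ->
  P.-integrable setT (EFin \o V) ->
  P.-integrable setT
    (EFin \o (fun w => V w * complex.Re (k * Cexp (- z * (L w)%:C)))).
Proof.
move=> z0 iV.
apply: (@le_integrable_fin _ (fun w => Normc.normc k * `|V w|)).
- by apply: measurable_funM => //; exact: measurable_Re_transform.
- by move=> w; rewrite normrM mulrC ler_wpM2r// abs_Re_transform_le.
- exact/integrable_finZl/(integrable_abse iV).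
Qed.

(** Lets a complex multiplier pass through the expectation, which is defined by its real and
    imaginary parts. *)
Lemma Rintegral_Re_transform k z : 0 <= complex.Re z ->
  P.-integrable setT (EFin \o V) ->
  \int[P]_w (V w * complex.Re (k * Cexp (- z * (L w)%:C))) =
  complex.Re (k * Cexpectation P (fun w => (V w)%:C * Cexp (- z * (L w)%:C))).
Proof.
move=> z0 iV; rewrite Cexpectation_transform.
have i1 := integrable_Re_transform 1 z0 iV.
have i2 := integrable_Re_transform (- 'i) z0 iV.
case: k => k1 k2.
rewrite (_ : complex.Re (_ * (?[A] +i* ?[B])) = k1 * ?A - k2 * ?B)// -!RintegralZl// -RintegralB//; last 2 first.
- exact: integrable_finZl.
- exact: integrable_finZl.
apply: eq_Rintegral => w _; rewrite -Im_Re mul1r.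
by case: (Cexp _) => [x y] /=; ring.
Qed.

Lemma transformN z : 0 <= complex.Re z -> P.-integrable setT (EFin \o V) ->
  Cexpectation P (fun w => (- V w)%:C * Cexp (- z * (L w)%:C)) =
  - Cexpectation P (fun w => (V w)%:C * Cexp (- z * (L w)%:C)).
Proof.
move=> z0 iV; rewrite !Cexpectation_transform.
have N k : \int[P]_w (- V w * complex.Re (k * Cexp (- z * (L w)%:C))) =
    - \int[P]_w (V w * complex.Re (k * Cexp (- z * (L w)%:C))).
  rewrite -[RHS]mulN1r -RintegralZl//; last exact: integrable_Re_transform.
  by apply: eq_Rintegral => w _; rewrite mulN1r mulNr.
by rewrite !N.
Qed.

Lemma transform0 : Cexpectation P (fun w => (V w)%:C * Cexp (- 0 * (L w)%:C)) =
  (\int[P]_w V w)%:C.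
Proof.
have E0 w : Cexp (- 0 * (L w)%:C) = 1.
  by rewrite oppr0 mul0r /Cexp/= expR0 cos0 sin0 mul1r mulr0.
rewrite Cexpectation_transform; congr (_ +i* _).
  by apply: eq_Rintegral => w _; rewrite E0 mulr1 mulr1.
rewrite (_ : 0 = \int[P]_(w in setT) (0 : R)); last by rewrite Rintegral_cst// mul0r.
by apply: eq_Rintegral => w _; rewrite E0 mulr1/= oppr0 mulr0.
Qed.

End transform.

(** * Differentiation of transforms on the closed half-plane *)

Section transform_derivative.
Context (R : realType) (dd : measure_display) (Omega : measurableType dd).
Variable P : probability Omega R.
Implicit Types (k a z : R[i]).
Variables (V L : Omega -> R).
Hypotheses (mV : measurable_fun setT V) (mL : measurable_fun setT L).
Hypothesis L0 : forall w, 0 <= L w.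
Hypothesis iV : P.-integrable setT (EFin \o V).
Hypothesis iVL : P.-integrable setT (EFin \o (fun w => V w * L w)).

(** The Taylor bound for the increment h = z - a, divided by n = |h|. *)
Let majorant (n : R) w := `|V w| * Num.min (2 * L w) (n * L w ^+ 2).

Let mmaj n : measurable_fun setT (majorant n).
Proof.
apply: measurable_funM; first exact: measurableT_comp.
apply: measurable_minr; first exact: measurable_funM.
by apply: measurable_funM => //; exact: measurable_funX.
Qed.

Let maj_ge0 n w : 0 <= n -> 0 <= majorant n w.
Proof.
by move=> n0; rewrite mulr_ge0// le_min !mulr_ge0//= exprn_ge0.
Qed.

Let maj_le n w : 0 <= n -> `|majorant n w| <= 2 * `|V w * L w|.
Proof.
move=> n0; rewrite ger0_norm ?maj_ge0// normrM (ger0_norm (L0 w)) mulrCA.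
by rewrite ler_wpM2l// ge_min lexx.
Qed.

Let i2VL : P.-integrable setT (EFin \o (fun w => 2 * `|V w * L w|)).
Proof.
exact/integrable_finZl/(integrable_abse iVL).
Qed.

Let imaj n : 0 <= n -> P.-integrable setT (EFin \o majorant n).
Proof.
move=> n0; apply: (le_integrable_fin (mmaj n) _ i2VL) => w; exact: maj_le.
Qed.

(** Dominated convergence: the quadratic part of the minimum tends to 0 with n, the linear part 2 |V
    L| dominates. *)
Let maj_cvg0 e : 0 < e ->
  exists2 n, 0 < n & forall m, 0 <= m -> m <= n -> \int[P]_w majorant m w <= e.
Proof.
move=> e0.
have := @dominated_cvg _ _ _ P setT measurableT
  (fun n => EFin \o majorant n.+1%:R^-1) (cst 0%E) (EFin \o (fun w => 2 * `|V w * L w|)).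
case/(_ _ _ _ i2VL _ [set x | (x < e%:E)%E] _).
- by move=> n; apply/measurable_EFinP; exact: mmaj.
- move=> w _; apply: cvg_EFin; first by near=> n.
  apply: (@squeeze_cvgr nat \oo _ R (cst 0) (fun n : nat => (`|V w| * L w ^+ 2) * n.+1%:R^-1)).
  + near=> n; rewrite /= maj_ge0//= /majorant -mulrA ler_wpM2l//.
    by rewrite ge_min [in X in _ || X]mulrC lexx orbT.
  + exact: cvg_cst.
  + rewrite -[X in _ --> X](mulr0 (`|V w| * L w ^+ 2)); apply: cvgM; first exact: cvg_cst.
    exact: cvg_harmonic.
- by [].
- by move=> n w _ /=; rewrite lee_fin maj_le.
- rewrite integral_cst// mul0e; apply: (@open_nbhs_nbhs _ 0%E); split => /=.
    exact: open_ereal_lt_ereal.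
  by rewrite lte_fin.
move=> N _ /(_ N (leqnn N)) /= h; exists N.+1%:R^-1 => // m m0 mN.
rewrite -lee_fin; apply: le_trans (ltW h).
rewrite /Rintegral fineK; last exact: integrable_fin_num (imaj m0).
apply: le_integral => //; [exact: imaj|exact: imaj|].
move=> w _; rewrite lee_fin ler_wpM2l// le_min ge_min lexx /=.
by rewrite ge_min ler_wpM2r ?orbT// exprn_ge0.
Unshelve. all: by end_near. Qed.

Let phi k z := \int[P]_w (V w * complex.Re (k * Cexp (- z * (L w)%:C))).

Let mVL : measurable_fun setT (fun w => V w * L w).
Proof. exact: measurable_funM. Qed.

Let remainder k a z : 0 <= complex.Re a -> 0 <= complex.Re z ->
  `|phi k z - phi k a
    + \int[P]_w (V w * L w * complex.Re (k * (z - a) * Cexp (- a * (L w)%:C)))|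
  <= Normc.normc k * Normc.normc (z - a) * \int[P]_w majorant (Normc.normc (z - a)) w.
Proof.
move=> a0 z0; set h := z - a; set n := Normc.normc h.
have n0 : 0 <= n by exact: normc_ge0.
have iz := integrable_Re_transform mV mL L0 k z0 iV.
have ia := integrable_Re_transform mV mL L0 k a0 iV.
have ih := integrable_Re_transform mVL mL L0 (k * h) a0 iVL.
have iB := integrableB measurableT iz ia.
have iD := integrableD measurableT iB ih.
rewrite /phi -RintegralB// -RintegralD//.
apply: le_trans (le_normr_Rintegral measurableT iD) _.
rewrite -RintegralZl//; last exact: imaj.
apply: le_Rintegral => //.
- exact: (integrable_abse iD).
- exact/integrable_finZl/imaj.
move=> w _.
set u := - a * (L w)%:C; set v := - h * (L w)%:C.
have uv : - z * (L w)%:C = u + v by rewrite /u /v /h -mulrDl; congr (_ * _); ring.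
have nv : Normc.normc v = n * L w.
  by rewrite /v Normc.normcM normcR (ger0_norm (L0 w)) normcN.
have u0 : complex.Re u <= 0 by rewrite Re_mulN_real oppr_le0 mulr_ge0.
have uv0 : complex.Re (u + v) <= 0 by rewrite -uv Re_mulN_real oppr_le0 mulr_ge0.
have := Re_Cexp_taylor k u0 uv0; rewrite nv => hT.
rewrite uv (_ : _ + _ = V w * complex.Re (k * (Cexp (u + v) - Cexp u - v * Cexp u))); last first.
  have -> : k * (Cexp (u + v) - Cexp u - v * Cexp u) =
      k * Cexp (u + v) - k * Cexp u + (L w)%:C * (k * h * Cexp u) by rewrite /v; ring.
  rewrite !Re_add; case: (k * Cexp u) (k * h * Cexp u) => [p1 p2] [r1 r2] /=; ring.
rewrite normrM /majorant mulrCA ler_wpM2l//.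
apply: le_trans hT _; rewrite -mulrA ler_wpM2l ?normc_ge0// minr_pMr//.
by rewrite mulrCA exprMn (expr2 n) -(mulrA n n).
Qed.

(** The difference quotient minus the claimed derivative is the Taylor remainder over z - a, of size
    at most the integral of [majorant] for each real part. Boundary points a are included, since
    both a and z range over the closed half-plane. *)
Lemma deriv_half_plane_transform (f : R[i] -> R[i]) a : 0 <= complex.Re a ->
  (forall z, 0 <= complex.Re z ->
     f z = Cexpectation P (fun w => (V w)%:C * Cexp (- z * (L w)%:C))) ->
  deriv_half_plane f a =
  - Cexpectation P (fun w => (V w * L w)%:C * Cexp (- a * (L w)%:C)).
Proof.
move=> a0 fE; apply: deriv_half_plane_eq => // e e0.
have [n n0 hn] := maj_cvg0 (divr_gt0 e0 (ltr0Sn _ 1)).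
exists n => // z z0 za zan; set m := Normc.normc (z - a) in zan *.
set l := - Cexpectation _ _; have za' : z - a != 0 by rewrite subr_eq0.
have m0 : 0 < m.
  rewrite lt_neqAle normc_ge0 andbT eq_sym.
  by apply: contra_neq za' => /Normc.eq0_normc.
have -> : (f z - f a) / (z - a) - l = (f z - f a - (z - a) * l) / (z - a).
  by field.
rewrite Normc.normcM Normc.normcV -/m ler_pdivrMr//.
apply: le_trans (normc_le_ReIm _) _.
have hk k : complex.Re (k * (f z - f a - (z - a) * l)) = phi k z - phi k a +
    \int[P]_w (V w * L w * complex.Re (k * (z - a) * Cexp (- a * (L w)%:C))).
  rewrite /phi !Rintegral_Re_transform// !fE// /l.
  set A := Cexpectation _ _; set B := Cexpectation _ _; set C := Cexpectation _ _.
  rewrite mulrN opprK mulrDr mulrBr !Re_add mulrA.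
  by case: (k * B) => [? ?].
have hG : \int[P]_w majorant m w <= e / 2 by exact: (hn _ (ltW m0) zan).
have hr k : Normc.normc k = 1 -> `|complex.Re (k * (f z - f a - (z - a) * l))| <= e / 2 * m.
  move=> k1; rewrite hk; apply: le_trans (remainder _ a0 z0) _.
  by rewrite k1 mul1r mulrC ler_wpM2r// ltW.
(* One half for the real part, one half for the imaginary part. *)
have -> : e * m = e / 2 * m + e / 2 * m by rewrite -mulrDl -splitr.
rewrite Im_Re; apply: lerD.
  by rewrite -[X in complex.Re X]mul1r; apply: hr; rewrite normcR normr1.
by apply: hr; rewrite /= oppr0 expr0n/= add0r sqrrN expr1n sqrtr1.
Qed.

End transform_derivative.

(** * Auxiliary facts on integrals and the exponential law *)

Section integrals.
Context (R : realType) (dd : measure_display) (Omega : measurableType dd).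

(* No measurability of [f] and [g]: the first passage time need not be measurable. *)
Lemma ge0_le_lower_integral (mu : {measure set Omega -> \bar R}) (D : set Omega)
    (f g : Omega -> \bar R) :
  (forall w, D w -> (0 <= f w)%E) -> (forall w, D w -> (f w <= g w)%E) ->
  (\int[mu]_(w in D) f w <= \int[mu]_(w in D) g w)%E.
Proof.
move=> f0 fg; rewrite !ge0_integralE//; last first.
  by move=> w Dw; exact: le_trans (f0 w Dw) (fg w Dw).
apply: le_ereal_sup => _ [h hf <-]; exists h => // w.
apply: le_trans (hf w) _; rewrite !patchE; case: ifPn => //.
by rewrite inE; exact: fg.
Qed.

Lemma integral_fin_indic (mu : {measure set Omega -> \bar R}) (D : set Omega) (f : Omega -> R) :
  (\int[mu]_(w in D) (f w)%:E = \int[mu]_w (f w * \1_D w)%:E)%E.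
Proof.
rewrite integral_mkcond; apply: eq_integral => w _.
by rewrite patchE indicE; case: ifPn; rewrite ?mulr1 ?mulr0.
Qed.

Variable P : probability Omega R.

Lemma integrable_indicM (D : set Omega) (f : Omega -> R) : measurable D ->
  P.-integrable setT (EFin \o f) ->
  P.-integrable setT (EFin \o (fun w => \1_D w * f w)).
Proof.
move=> mD i_f; have mf := measurable_int _ i_f.
apply: (@le_integrable_fin _ _ _ _ _ (fun w => `|f w|)).
- by apply: measurable_funM => //; apply/measurable_EFinP.
- by move=> w; rewrite normrM ler_piMl// indicE; case: (w \in D); rewrite ?normr1 ?normr0.
- exact: (integrable_abse i_f).
Qed.

Lemma measure_partition (d : nat) (K : Omega -> 'I_d) (A : set Omega) :
  measurable A -> (forall i, measurable [set w | K w = i]) ->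
  P A = (\sum_(i < d) P (A `&` [set w | K w = i]))%E.
Proof.
move=> mA mK.
have AE : A = \big[setU/set0]_(i < d) (A `&` [set w | K w = i]).
  rewrite -bigcup_seq; apply/seteqP; split => [w Aw|w [i _ []]//].
  by exists (K w) => //=; exact: mem_index_enum.
rewrite [in LHS]AE measure_semi_additive_ord// -?AE// => [i|].
  exact: measurableI.
by apply/trivIsetP => i j _ _ /eqP ij; apply/seteqP; split => // w /= [[_ Ki] [_ Kj]]; apply: ij; rewrite -Ki -Kj.
Qed.

Lemma Rintegral_sum (I : Type) (r : seq I) (f : I -> Omega -> R) :
  (forall i, P.-integrable setT (EFin \o f i)) ->
  \int[P]_w (\sum_(i <- r) f i w) = \sum_(i <- r) \int[P]_w f i w.
Proof.
move=> i_f; elim: r => [|i r IH].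
  by under eq_Rintegral do rewrite big_nil; rewrite big_nil Rintegral_cst// mul0r.
under eq_Rintegral do rewrite big_cons.
rewrite RintegralD// ?IH ?big_cons//.
have := @integrable_sum _ _ _ P _ measurableT _ r xpredT (fun i => EFin \o f i) (fun i _ => i_f i).
by apply: eq_integrable => // w _; rewrite /= sumEFin.
Qed.

(** The law has no atoms, so both tails agree. The strict and the weak one are each used, for the
    two sides of the squeeze around tau(y). *)
Lemma exponential_tail (T : Omega -> R) (theta s : R) : 0 < theta ->
  exponentially_distributed P theta T -> 0 <= s ->
  P [set v | s < T v] = (expR (- theta * s))%:E /\
  P [set v | s <= T v] = (expR (- theta * s))%:E.
Proof.
move=> theta0 [mT T0 TE] s0.
have mI (B : set R) : measurable B -> measurable (T @^-1` B).
  by move=> mB; rewrite -[X in measurable X]setTI; exact: mT.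
have atom (x : R) : P (T @^-1` [set x]) = 0%E.
  rewrite TE// /exponential_prob; apply: null_set_integral => //.
    by apply: measurable_funTS; apply/measurable_EFinP; exact: measurable_exponential_pdf.
  exact: lebesgue_measure_set1.
have le : P (T @^-1` `[0, s]) = (1 - (expR (- theta * s))%:E)%E.
  (* For s = 0 the interval is a single point, of mass zero. *)
  move: s0; rewrite le_eqVlt => /predU1P[<-|s0]; last by rewrite TE// exponential_prob_itv0c.
  by rewrite set_itv1 atom mulr0 expR0 subee.
have gt : P [set v | s < T v] = (expR (- theta * s))%:E.
  have -> : [set v | s < T v] = ~` (T @^-1` `[0, s]).
    apply/seteqP; split => v /=; rewrite in_itv/= T0/= ltNge; first by move/negP.
    by move/negP.
  rewrite probability_setC; last exact: mI.
  by rewrite le -[LHS]/((1 - (1 - expR (- theta * s)))%:E) opprB addrC subrK.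
split => //.
have -> : [set v | s <= T v] = [set v | s < T v] `|` T @^-1` [set s].
  apply/seteqP; split => v /=; first by rewrite le_eqVlt => /predU1P[->|]; [right|left].
  by case=> [/ltW|->].
rewrite measureU0//; [|exact: mI|exact: atom].
rewrite (_ : [set v | _] = T @^-1` `]s, +oo[); first exact: mI.
by apply/seteqP; split => v /=; rewrite in_itv/= andbT.
Qed.

End integrals.

Lemma cvg_sum_real (R : realType) (T I : Type) (F : set_system T) (r : seq I)
    (f : I -> T -> R) (l : I -> R) : Filter F ->
  (forall i, f i x @[x --> F] --> l i) ->
  \sum_(i <- r) f i x @[x --> F] --> \sum_(i <- r) l i.
Proof.
move=> FF fl; elim: r => [|i r IH].
  by under eq_fun do rewrite big_nil; rewrite big_nil; exact: cvg_cst.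
by under eq_fun do rewrite big_cons; rewrite big_cons; exact: cvgD.
Qed.

(** * Sums of complex exponentials and their tail integrals *)

Section exponential_sum.
Context (R : realType).
Implicit Types (k p : R[i]) (x y : R).

Lemma is_derive_Re_expN k p y :
  is_derive y 1 (fun y => complex.Re (k * Cexp (- p * y%:C)))
    (- complex.Re (k * p * Cexp (- p * y%:C))).
Proof.
have := is_derive_Re_Cexp k 0 (- p) y; congr (is_derive _ _ _ _).
  by apply/funext => x; rewrite add0r [_%:C * _]mulrC.
rewrite add0r [_%:C * _]mulrC mulrN mulNr.
by case: (k * p * _).
Qed.

Lemma continuous_Re_expN k p : continuous (fun y : R => complex.Re (k * Cexp (- p * y%:C))).
Proof.
move=> y; apply/differentiable_continuous/derivable1_diffP.
by have [] := is_derive_Re_expN k p y.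
Qed.

Lemma cvg_Re_expN k p : 0 < complex.Re p ->
  complex.Re (k * Cexp (- p * y%:C)) @[y --> +oo] --> (0 : R).
Proof.
move=> p0; apply: norm_cvg0.
have h : Normc.normc k * expR (- (complex.Re p * y)) @[y --> +oo] --> (0 : R).
  rewrite -[X in _ --> X](mulr0 (Normc.normc k)); apply: cvgM; first exact: cvg_cst.
  apply: (@cvg_comp _ _ _ (fun y => complex.Re p * y) (fun z => expR (- z)) _ (pinfty_nbhs R)).
    exact: gt0_cvgMry.
  exact: cvgr_expR.
apply: (@squeeze_cvgr _ _ _ _ (cst 0) (fun y : R => Normc.normc k * expR (- (complex.Re p * y)))) => //.
  apply: nearW => y; rewrite normr_ge0/=; apply: le_trans (abs_Re_le_normc _) _.
  by rewrite Normc.normcM normc_Cexp Re_mulN_real.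
exact: cvg_cst.
Qed.

Variables (d : nat) (c p : 'I_d -> R[i]).
Hypothesis p0 : forall j, 0 < complex.Re (p j).

(** The coefficients are an argument because two families share the exponents: [c j] and
    [c j / p j], the latter giving minus an antiderivative of the former. *)
Definition exp_sum (c : 'I_d -> R[i]) y : R[i] := \sum_(j < d) c j * Cexp (- p j * y%:C).

Lemma Re_sum (a : 'I_d -> R[i]) : complex.Re (\sum_j a j) = \sum_j complex.Re (a j).
Proof. by elim/big_rec2: _ => // j x y _ <-; rewrite Re_add. Qed.

Lemma Re_exp_sum k e y :
  complex.Re (k * exp_sum e y) = \sum_j complex.Re (k * e j * Cexp (- p j * y%:C)).
Proof.
by rewrite mulr_sumr Re_sum; apply: eq_bigr => j _; rewrite mulrA.
Qed.

Lemma continuous_Re_exp_sum k e : continuous (fun y => complex.Re (k * exp_sum e y)).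
Proof.
under eq_fun do rewrite Re_exp_sum.
by move=> y; apply: cvg_sum_real => j; exact: continuous_Re_expN.
Qed.

Lemma cvg_Re_exp_sum k e : complex.Re (k * exp_sum e y) @[y --> +oo] --> (0 : R).
Proof.
under eq_fun do rewrite Re_exp_sum.
have := @cvg_sum_real R R _ (pinfty_nbhs R) (index_enum 'I_d) _ _ _
  (fun j => cvg_Re_expN (k * e j) (p0 j)).
by rewrite big1//; apply; exact: pinfty_nbhs_filter.
Qed.

Lemma is_derive_Re_exp_sum k y :
  is_derive y 1 (fun y => complex.Re (k * exp_sum (fun j => c j / p j) y))
    (- complex.Re (k * exp_sum c y)).
Proof.
have pn0 j : p j != 0 by apply: contra_eq_neq (gt_eqF (p0 j)) => ->; rewrite eqxx.
have h := @is_derive_sum _ _ _ d (fun j (y : R) => complex.Re (k * (c j / p j) * Cexp (- p j * y%:C)))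
  y 1 _ (fun j => is_derive_Re_expN (k * (c j / p j)) (p j) y).
move: h; congr (is_derive _ _ _ _).
  by apply/funext => x; rewrite fct_sumE Re_exp_sum.
rewrite Re_exp_sum -sumrN; apply: eq_bigr => j _.
by rewrite -[k * _ * p j]mulrA divfK.
Qed.

(** The antiderivative with coefficients - c j / p j vanishes at infinity because Re (p j) > 0. *)
Lemma integral_exp_sum k q : 0 <= q ->
  (forall y, 0 < y -> 0 <= complex.Re (k * exp_sum c y)) ->
  (\int[lebesgue_measure]_(y in `[q, +oo[) (complex.Re (k * exp_sum c y))%:E =
   (complex.Re (k * exp_sum (fun j => c j / p j) q))%:E)%E.
Proof.
move=> q0 pos.
(* The sign is known for y > 0 only; continuity extends it to 0, which is needed when q = 0. *)
have pos0 y : 0 <= y -> 0 <= complex.Re (k * exp_sum c y).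
  rewrite le_eqVlt => /predU1P[<-|]; last exact: pos.
  apply: (@cvgr_to_ge _ (0 : R)^'+ _ _ (fun y => complex.Re (k * exp_sum c y))).
    exact/cvg_at_right_filter/continuous_Re_exp_sum.
  by near=> x; apply: pos.
have cvF := @continuous_Re_exp_sum k (fun j => c j / p j).
rewrite (@ge0_continuous_FTC2y _ _
  (fun y => - complex.Re (k * exp_sum (fun j => c j / p j) y)) _ 0).
- by rewrite add0e EFinN oppeK.
- by move=> y qy; apply: pos0; exact: le_trans qy.
- exact/continuous_subspaceT/continuous_Re_exp_sum.
- by rewrite -oppr0; apply: cvgN; exact: cvg_Re_exp_sum.
- by move=> x _; apply: derivableN; have [] := is_derive_Re_exp_sum k x.
- by apply: cvgN; exact/cvg_at_right_filter/cvF.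
- move=> x _; rewrite derive1E deriveN; last by have [] := is_derive_Re_exp_sum k x.
  by have [_ ->] := is_derive_Re_exp_sum k x; rewrite opprK.
Unshelve. all: by end_near. Qed.

Lemma Re_exp_sum_bounded k e : exists M : R,
  forall y, 0 <= y -> `|complex.Re (k * exp_sum e y)| <= M.
Proof.
exists (\sum_j Normc.normc (k * e j)) => y y0; rewrite Re_exp_sum.
apply: le_trans (ler_norm_sum _ _ _) _; apply: ler_sum => j _.
by apply: abs_Re_Cexp_le; rewrite Re_mulN_real oppr_le0 mulr_ge0// ltW.
Qed.

(** The imaginary part of the tail sum is the tail integral of the imaginary part of the sum [c],
    which vanishes for y > 0. *)
Lemma real_exp_sum_primitive (s : R -> R) q : 0 <= q ->
  (forall y, 0 < y -> (s y)%:C = exp_sum c y) ->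
  exp_sum (fun j => c j / p j) q =
  (complex.Re (exp_sum (fun j => c j / p j) q))%:C.
Proof.
move=> q0 hs.
have Im0 y : 0 < y -> complex.Re (- 'i * exp_sum c y) = 0.
  by move=> /hs <-; rewrite -Im_Re.
have : complex.Im (exp_sum (fun j => c j / p j) q) = 0.
  rewrite Im_Re; apply: EFin_inj; rewrite -integral_exp_sum//; last first.
    by move=> y /Im0 ->.
  (* On the open half-line every y is positive, even if q = 0. *)
  rewrite -integral_itv_obnd_cbnd.
    apply: integral0_eq => y /=; rewrite in_itv/= andbT => qy.
    by rewrite Im0// (le_lt_trans q0).
  apply: measurable_funTS; apply/measurable_EFinP.
  by apply: continuous_measurable_fun; exact: continuous_Re_exp_sum.
by case: (exp_sum (fun j => c j / p j) q) => x y /= ->.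
Qed.

End exponential_sum.

(** * Expected excess from tail probabilities *)

Section excess.
Context (R : realType) (dd : measure_display) (Omega : measurableType dd).
Variable P : probability Omega R.

(** (m - q)^+ is the length of ]q, m[. After Tonelli the indicator of y < m is replaced by [s y] at
    each level y, and integrating back over y > q gives [F q]. *)
Lemma expected_excess (G q m : Omega -> R) (s F : R -> R) :
  measurable_fun setT G -> measurable_fun setT q -> measurable_fun setT m ->
  measurable_fun setT s ->
  (forall w, 0 <= G w) -> (forall w, 0 <= q w) -> (forall y, 0 < y -> 0 <= s y) ->
  (forall x, 0 <= x -> (\int[lebesgue_measure]_(y in `]x, +oo[) (s y)%:E = (F x)%:E)%E) ->
  (forall y, 0 < y -> (\int[P]_w (G w * \1_[set z | q z < y] w * \1_[set z | y < m z] w)%:E =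
    \int[P]_w (G w * \1_[set z | q z < y] w * s y)%:E)%E) ->
  (\int[P]_w (G w * Num.max (m w - q w) 0)%:E = \int[P]_w (G w * F (q w))%:E)%E.
Proof.
move=> mG mq mm ms G0 q0 s0 sF hs.
pose A : set (R * Omega) := [set p | q p.2 < p.1].
pose B : set (R * Omega) := [set p | p.1 < m p.2].
have mA : measurable A.
  rewrite -[A]setTI; apply: measurable_fun_ltr => //.
  exact: measurableT_comp measurable_snd.
have mB : measurable B.
  rewrite -[B]setTI; apply: measurable_fun_ltr => //.
  exact: measurableT_comp measurable_snd.
have mG2 : measurable_fun setT (fun p : R * Omega => G p.2).
  exact: measurableT_comp measurable_snd.
have ms1 : measurable_fun setT (fun p : R * Omega => s p.1).
  exact: measurableT_comp measurable_fst.
have mAi : measurable_fun setT (\1_A : R * Omega -> R) by exact: measurable_indic.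
have mBi : measurable_fun setT (\1_B : R * Omega -> R) by exact: measurable_indic.
pose f (p : R * Omega) : \bar R := (G p.2 * \1_A p * \1_B p)%:E.
pose g (p : R * Omega) : \bar R := (G p.2 * \1_A p * s p.1)%:E.
have mf : measurable_fun setT f.
  by apply/measurable_EFinP; do 2 apply: measurable_funM => //.
have mg : measurable_fun setT g.
  by apply/measurable_EFinP; do 2 apply: measurable_funM => //.
have f0 p : (0 <= f p)%E by rewrite lee_fin !mulr_ge0.
have g0 p : (0 <= g p)%E.
  rewrite lee_fin indicE; have [|_] := boolP (p \in A); last by rewrite mulr0 mul0r.
  by rewrite inE /A/= => qp; rewrite mulr1 mulr_ge0// s0// (le_lt_trans (q0 _) qp).
have fE w : (\int[lebesgue_measure]_y f (y, w) = (G w * Num.max (m w - q w) 0)%:E)%E.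
  rewrite EFinM (_ : (Num.max _ _)%:E = lebesgue_measure `]q w, m w[%classic); last first.
    rewrite lebesgue_measure_itv/= lte_fin; case: ltP => qm; last first.
      by rewrite max_r// subr_le0.
    by rewrite -EFinB max_l// subr_ge0 ltW.
  rewrite -[in RHS](setIT `]q w, m w[%classic) -integral_indic//.
  rewrite -ge0_integralZl_EFin//; last first.
    by apply/measurable_EFinP; exact: measurable_indic.
  apply: eq_integral => y _; rewrite /f -EFinM -mulrA; congr (_ * _)%:E.
  rewrite !indicE -natrM mulnb; congr (_%:R); congr nat_of_bool; apply/andP/idP; rewrite !inE/= in_itv/=.
    by case=> -> ->.
  by case/andP.
have gE w : (\int[lebesgue_measure]_y g (y, w) = (G w * F (q w))%:E)%E.
  rewrite EFinM -sF// [in RHS]integral_fin_indic.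
  rewrite -ge0_integralZl_EFin//; last 2 first.
    move=> y _; rewrite lee_fin indicE; have [|_] := boolP (y \in _); last by rewrite mulr0.
    by rewrite inE/= in_itv/= andbT mulr1 => qy; rewrite s0// (le_lt_trans (q0 w) qy).
    by apply/measurable_EFinP; apply: measurable_funM => //; exact: measurable_indic.
  apply: eq_integral => y _; rewrite /g -EFinM -mulrA [\1_A _ * _]mulrC; congr (_ * (_ * _))%:E.
  rewrite !indicE; congr (_%:R); congr nat_of_bool; apply/idP/idP; rewrite !inE/= in_itv/=.
    by move=> ->.
  by rewrite andbT.
have fub h : measurable_fun setT h -> (forall p, (0 <= h p)%E) ->
    (\int[P]_w \int[lebesgue_measure]_y h (y, w) =
     \int[lebesgue_measure]_y \int[P]_w h (y, w))%E.
  by move=> mh h0; apply/esym; exact: (fubini_tonelli h mh h0).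
transitivity (\int[P]_w \int[lebesgue_measure]_y f (y, w))%E.
  by apply: eq_integral => w _; rewrite fE.
transitivity (\int[P]_w \int[lebesgue_measure]_y g (y, w))%E; last first.
  by apply: eq_integral => w _; rewrite gE.
rewrite !fub//; apply: eq_integral => y _.
(* For y <= 0 the condition q < y fails, as q >= 0, and both integrands vanish. *)
have [y0|y0] := ltP 0 y; first exact: hs.
apply: eq_integral => w _; rewrite /f /g indicE memNset ?mulr0 ?mul0r//.
by rewrite /A/=; apply/negP; rewrite -leNgt (le_trans y0).
Qed.

End excess.

(** Links the transforms evaluated at the exponents with the expectation of an exponential sum at
    [L]; with e j = c_ij / psi_j this is how the kappa_i'(psi_j) enter. *)
Lemma exp_sum_transform (R : realType) (dd : measure_display) (Omega : measurableType dd)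
    (P : probability Omega R) (V L : Omega -> R) (d : nat) (p e : 'I_d -> R[i]) (k : R[i]) :
  measurable_fun setT V -> measurable_fun setT L -> (forall w, 0 <= L w) ->
  (forall j, 0 <= complex.Re (p j)) -> P.-integrable setT (EFin \o V) ->
  complex.Re (k * \sum_j e j *
    Cexpectation P (fun w => (V w)%:C * Cexp (- p j * (L w)%:C))) =
  \int[P]_w (V w * complex.Re (k * exp_sum p e (L w))).
Proof.
move=> mV mL L0 p0 iV; rewrite mulr_sumr Re_sum.
under eq_bigr => j _ do rewrite mulrA -Rintegral_Re_transform//.
rewrite -Rintegral_sum; last by move=> j; exact: integrable_Re_transform.
by apply: eq_Rintegral => w _; rewrite Re_exp_sum mulr_sumr.
Qed.

(** * The workload at the sampling time *)

Section workload.
Context (R : realType) (dd : measure_display) (Omega : measurableType dd).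
Variable P : probability Omega R.
Context (d : nat) (q : 'M[R]_d).
Variables (Y : 'I_d -> R -> Omega -> R) (U : 'I_d -> 'I_d -> nat -> Omega -> R).
Variables (X : R -> Omega -> R) (J : R -> Omega -> 'I_d) (Q : R -> Omega -> R).
Variables (theta : R) (T : Omega -> R).
Hypothesis hmap : spectrally_positive_map P Y U X J q.
Hypothesis hQ : stationary_workload P X J Q.
Hypothesis theta0 : 0 < theta.
Hypothesis hT : exponentially_distributed P theta T.
Hypothesis hTindep : independent_classes P (sigma_var T) (sigma_all Y U X J Q).

Let cX w : cadlag (X ^~ w). Proof. exact: map_cadlag hmap w. Qed.
Let mX t : 0 <= t -> measurable_fun setT (X t).
Proof. exact: map_measurable hmap t. Qed.
Let mQ0 : measurable_fun setT (Q 0). Proof. exact: workload_measurable hQ. Qed.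
Let mT : measurable_fun setT T. Proof. by case: hT. Qed.
Let T0 w : 0 <= T w. Proof. by case: hT. Qed.

Let state i : set Omega := [set w | J 0 w = i].

Let measurable_state t i : 0 <= t -> measurable [set w | J t w = i].
Proof. exact: mc_measurable (map_chain hmap) t i. Qed.

Let M t w : R := - inf [set X u w | u in `[0, t]].

Let workload0_ge0 w : 0 <= Q 0 w.
Proof.
rewrite (workload_formula hQ)// set_itv1 image_set1 inf1 (map_zero hmap).
by rewrite add0r oppr0 le_max lexx orbT.
Qed.

Let workload_ge0 t w : 0 <= t -> 0 <= Q t w.
Proof.
move=> t0; rewrite (workload_formula hQ)//.
apply: (@le_trans _ _ (X t w - X t w)); first by rewrite subrr.
rewrite lerD2l le_max; apply/orP; right; rewrite lerN2.
apply: ge_inf; first exact: cadlag_has_lbound.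
by exists t => //=; rewrite in_itv/= t0 lexx.
Qed.

(** Two levels of information: [S1] knows [X] and [J], the events to which
    [workload_cond_independent] applies; [S2] also knows [Q 0] and is still independent of [T]. *)
Let G1 := sigma_process X `|` sigma_chain J.
Let G2 := sigma_var (Q 0) `|` sigma_map X J.
Let S1 := g_sigma_algebraType G1.
Let S2 := g_sigma_algebraType G2.

Let sigma_map_measurable : sigma_map X J `<=` measurable.
Proof.
apply: smallest_sub; first exact: sigma_algebra_measurable.
move=> A [|]; move: A; apply: smallest_sub; try exact: sigma_algebra_measurable.
  move=> A [t /= t0] [B mB <-]; exact: mX.
move=> A [t /= t0] [B _ <-]; rewrite setTI.
rewrite (_ : _ @^-1` _ = \bigcup_(i in B) [set w | J t w = i]).
  by apply: fin_bigcup_measurable => // i _; exact: measurable_state.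
by apply/seteqP; split => [w Bw|w [i Bi /= Ji]]; [by exists (J t w)|rewrite /= Ji].
Qed.

Let G2_measurable : <<s G2>> `<=` measurable.
Proof.
apply: smallest_sub; first exact: sigma_algebra_measurable.
move=> A [[B mB <-]|]; [exact: mQ0|exact: sigma_map_measurable].
Qed.

Let TG2 : independent_classes P (sigma_var T) <<s G2>>.
Proof.
move=> A B TA GB; apply: hTindep => //; move: B GB; apply: smallest_sub.
  exact: smallest_sigma_algebra.
by move=> B GB; apply: sub_sigma_algebra; left.
Qed.

Let mX1 t : 0 <= t -> measurable_fun setT (X t : S1 -> R).
Proof.
move=> t0 _ B mB; apply: sub_sigma_algebra; left; apply: sub_sigma_algebra.
by exists t => //; exists B.
Qed.

Let mid12 : measurable_fun setT (id : S2 -> S1).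
Proof.
move=> _ B mB; rewrite setTI; apply: sub_sigma_algebra; right; exact: mB.
Qed.

Let Xp (p : R * S1) : R := X (Num.max p.1 0) p.2.
Let Mp (p : R * S1) : R := M (Num.max p.1 0) p.2.

Let mXp : measurable_fun setT Xp.
Proof. exact: (@measurable_cadlag_process _ _ S1). Qed.

Let mMp : measurable_fun setT Mp.
Proof. exact: (@measurable_running_sup _ _ S1). Qed.

(** The identity, used to carry measurability from [S1] to the finer [S2]. *)
Let pair12 (p : R * S2) : R * S1 := p.

Let mpair12 : measurable_fun setT pair12.
Proof.
apply/measurable_fun_pairP; split; first exact: measurable_fst.
exact: measurableT_comp mid12 measurable_snd.
Qed.

Let mQ0p : measurable_fun setT (fun p : R * S2 => Q 0 p.2).
Proof.
apply: (@measurableT_comp _ _ _ _ _ _ (Q 0 : S2 -> R)); last exact: measurable_snd.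
by move=> _ B mB; apply: sub_sigma_algebra; left; exists B.
Qed.

Let mstate_p i : measurable [set p : R * S2 | state i p.2].
Proof.
rewrite (_ : [set p | _] = setT `*` (state i : set S2)); last first.
  by apply/seteqP; split => p /=; [|case].
apply: measurableX => //.
apply: sub_sigma_algebra; right; apply: sub_sigma_algebra; right.
apply: sub_sigma_algebra; exists 0 => //=; exists [set i] => //.
by rewrite setTI.
Qed.

Let mfp (f : R * S1 -> R) (B : set R) : measurable_fun setT f -> measurable B ->
  measurable [set p : R * S2 | B (f p)].
Proof.
move=> mf mB; rewrite -[X in measurable X]setTI.
exact: (measurableT_comp mf mpair12).
Qed.

Let mfT (f : R * S1 -> R) : measurable_fun setT f ->
  measurable_fun setT (fun w => f (T w, w)).
Proof.
move=> mf _ B mB; rewrite setTI.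
exact: (measurable_independent_time mT G2_measurable (mfp mf mB)).
Qed.

(** With the time frozen at T v, the event about f is an event of [X] and [J], to which conditional
    independence applies; integrating over v gives the claim at the random time. *)
Let workload_independent_time i (f : R * S1 -> R) (A B : set R) :
  measurable_fun setT f -> measurable A -> measurable B ->
  (P (state i) * P (Q 0 @^-1` A `&` (fun w => f (T w, w)) @^-1` B `&` state i) =
   P (Q 0 @^-1` A `&` state i) * P ((fun w => f (T w, w)) @^-1` B `&` state i))%E.
Proof.
move=> mf mA mB.
have mD2 : measurable ([set p : R * S2 | B (f p)] `&` [set p | state i p.2]).
  by apply: measurableI => //; exact: mfp.
have mD1 : measurable ([set p : R * S2 | A (Q 0 p.2)] `&` [set p | B (f p)]
    `&` [set p | state i p.2]).
  apply: measurableI => //; apply: measurableI; last exact: mfp.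
  by rewrite -[X in measurable X]setTI; exact: mQ0p.
have h1 := independent_time_fubini1 mT G2_measurable TG2 mD1.
have h2 := independent_time_fubini1 mT G2_measurable TG2 mD2.
rewrite [X in (P (state i) * X)%E]h1 [X in _ = (_ * X)%E]h2.
rewrite -!ge0_integralZl//; last 2 first.
- exact: (measurable_fun_time_xsection P mT G2_measurable mD2).
- exact: (measurable_fun_time_xsection P mT G2_measurable mD1).
apply: eq_integral => v _.
apply: (workload_cond_independent hQ).
  by exists A => //; rewrite setTI.
have := measurableT_comp mf (measurable_pair1 (T v)).
move=> /(_ measurableT _ mB); rewrite setTI; exact.
Qed.

Let XT w : R := X (T w) w.
Let MT w : R := M (T w) w.
Let QT w : R := Q (T w) w.

Let XTE : XT = fun w => Xp (T w, w).
Proof. by apply/funext => w; rewrite /XT /Xp/= max_l. Qed.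

Let MTE : MT = fun w => Mp (T w, w).
Proof. by apply/funext => w; rewrite /MT /Mp/= max_l. Qed.

Let mXT : measurable_fun setT XT. Proof. by rewrite XTE; exact: mfT. Qed.
Let mMT : measurable_fun setT MT. Proof. by rewrite MTE; exact: mfT. Qed.

Let QTE w : QT w = XT w + Num.max (Q 0 w) (MT w).
Proof. by rewrite /QT (workload_formula hQ). Qed.

(** What reflection at 0 adds to Q_0 + X_T by time T. *)
Let W w : R := Num.max (MT w - Q 0 w) 0.

Let mQT : measurable_fun setT QT.
Proof.
rewrite (_ : QT = fun w => XT w + Num.max (Q 0 w) (MT w)); last exact/funext/QTE.
by apply: measurable_funD => //; exact: measurable_maxr.
Qed.

(** Stationarity at each frozen time T v. It is given jointly with the background state, hence the
    detour through a sum over states. *)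
Let workload_law (B : set R) : measurable B -> P (QT @^-1` B) = P (Q 0 @^-1` B).
Proof.
move=> mB.
pose D := [set p : R * S2 | B (Xp p + Num.max (Q 0 p.2) (Mp p))].
have mD : measurable D.
  rewrite -[D]setTI.
  have : measurable_fun setT (fun p : R * S2 => Xp p + Num.max (Q 0 p.2) (Mp p)).
    apply: measurable_funD; first exact: measurableT_comp mXp mpair12.
    by apply: measurable_maxr => //; exact: measurableT_comp mMp mpair12.
  by move=> /(_ measurableT _ mB).
have -> : QT @^-1` B = [set w | D (T w, w)].
  by apply/seteqP; split => w; rewrite /D/= QTE XTE MTE.
rewrite (independent_time_fubini1 mT G2_measurable TG2 mD).
under eq_integral => v _.
  have maxT : Num.max (T v) 0 = T v by rewrite max_l.
  have -> : [set w | D (T v, w)] = Q (T v) @^-1` B.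
    by apply/seteqP; split => w; rewrite /D/= (workload_formula hQ w (T0 v)) /Xp /Mp /= maxT.
  rewrite (@measure_partition _ _ _ P d (J (T v)))//; last 2 first.
    rewrite (_ : Q (T v) = fun w => X (T v) w + Num.max (Q 0 w) (M (T v) w)); last first.
      by apply/funext => w; rewrite (workload_formula hQ).
    rewrite -[X in measurable X]setTI; apply: measurable_funD => //; first exact: mX.
    apply: measurable_maxr => //.
    have := measurable_running_sup mX cX.
    move=> /measurableT_comp /(_ (measurable_pair1 (T v))).
    by congr measurable_fun; apply/funext => w /=; rewrite maxT.
    by move=> i; exact: measurable_state.
  under eq_bigr => i _ do rewrite (workload_stationary hQ)//.
  rewrite -(@measure_partition _ _ _ P d (J 0) (Q 0 @^-1` B))//; last 2 first.
    by rewrite -[X in measurable X]setTI; exact: mQ0.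
    by move=> i; exact: measurable_state.
  over.
rewrite integral_cst// -[RHS]mule1; congr (_ * _)%E; exact: probability_setT.
Qed.

(** * The law of M_T given the initial state *)

Section fixed_state.
Variable i : 'I_d.

Let passage y w : R := fine (expeR (- (theta%:E * first_passage X y w)))%E.

Let first_passage_ge0 y w : (0 <= first_passage X y w)%E.
Proof. by apply: le_ereal_inf_tmp => _ [t /= [t0 _] <-]; rewrite lee_fin. Qed.

Let passage_ge0 y w : 0 <= passage y w.
Proof. by rewrite fine_ge0// expeR_ge0. Qed.

(** The conditional probability of M_T > y given the path: the path of [w] is fixed and only the
    time varies, through v. *)
Let exceed y w : \bar R := P [set v | y < M (T v) w].

Let measurable_exceed y : measurable [set p : R * S2 | y < Mp p].
Proof.
have := mfp mMp (measurable_itv `]y, +oo[).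
by congr measurable; apply/seteqP; split => p /=; rewrite in_itv/= andbT.
Qed.

Let exceedE y : exceed y = fun w => P [set v | [set p : R * S2 | y < Mp p] (T v, w)].
Proof.
apply/funext => w; congr (P _); apply/seteqP; split => v /=;
  by rewrite /Mp/= max_l.
Qed.

Let measurable_exceed_time y w : measurable [set v | y < M (T v) w].
Proof.
have := measurable_ysection (w : S2) (measurable_exceed y) => mE.
have := mT measurableT mE; rewrite setTI; congr measurable.
by apply/seteqP; split => v /=; rewrite /ysection/= inE/= /Mp/= max_l.
Qed.

Let passage_fin y w s : first_passage X y w = s%:E -> passage y w = expR (- theta * s).
Proof. by move=> fpE; rewrite /passage fpE/= mulNr. Qed.

Let passage_infty y w : first_passage X y w = +oo%E -> passage y w = 0.
Proof. by move=> fpE; rewrite /passage fpE gt0_muley// lte_fin. Qed.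

(** M_T > y forces tau(y) <= T, and P(T >= s) = exp(- theta s) at s = tau(y). *)
Let exceed_le_passage y w : (exceed y w <= (passage y w)%:E)%E.
Proof.
have fp_le v : y < M (T v) w -> (first_passage X y w <= (T v)%:E)%E.
  move=> /running_inf_lt => /(_ (cX w) (T0 v))[u /andP[u0 uT] Xu].
  apply: ge_ereal_inf; exists u%:E; last by rewrite lee_fin.
  by exists u => //; split => //; exact: ltW.
have := first_passage_ge0 y w; case fpE : (first_passage X y w) => [s| |]// s0.
  rewrite (passage_fin fpE); have [_ <-] := exponential_tail theta0 hT s0.
  apply: le_measure; rewrite ?inE.
  - exact: measurable_exceed_time.
  - rewrite (_ : [set v | _] = setT `&` T @^-1` `[s, +oo[); first exact: mT.
    by rewrite setTI; apply/seteqP; split => v /=; rewrite in_itv/= andbT.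
  - by move=> v /= /fp_le; rewrite fpE lee_fin.
rewrite (passage_infty fpE) /exceed (_ : [set v | _] = set0) ?measure0//.
by apply/seteqP; split => v //= /fp_le; rewrite fpE.
Qed.

(** If tau(y) < T, some u < T has X_u <= -y, which is strictly below -y'. The loss of level is the
    price of the strict inequality in M_T > y'. *)
Let passage_le_exceed y y' w : y' < y -> ((passage y w)%:E <= exceed y' w)%E.
Proof.
move=> yy'.
have := first_passage_ge0 y w; case fpE : (first_passage X y w) => [s| |]// s0; last first.
  by rewrite (passage_infty fpE).
rewrite (passage_fin fpE); have [<- _] := exponential_tail theta0 hT s0.
apply: le_measure; rewrite ?inE.
- rewrite (_ : [set v | _] = setT `&` T @^-1` `]s, +oo[); first exact: mT.
  by rewrite setTI; apply/seteqP; split => v /=; rewrite in_itv/= andbT.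
- exact: measurable_exceed_time.
move=> v /= sT; have : (first_passage X y w < (T v)%:E)%E by rewrite fpE lte_fin.
move=> /ereal_inf_lt[_ [u [u0 Xu] <-]]; rewrite lte_fin => uT.
apply/(running_inf_lt _ (cX w) (T0 v)); exists u; first by rewrite u0 ltW.
by apply: le_lt_trans Xu _; rewrite ltrN2.
Qed.

Let exceed_integral y :
  P (MT @^-1` `]y, +oo[ `&` state i) = (\int[P]_(w in state i) exceed y w)%E.
Proof.
have mD : measurable ([set p : R * S2 | y < Mp p] `&` [set p | state i p.2]).
  exact: measurableI.
rewrite (_ : _ `&` _ = [set w | ([set p : R * S2 | y < Mp p] `&` [set p | state i p.2]) (T w, w)]); last first.
  by apply/seteqP; split => w /=; rewrite MTE in_itv/= andbT.
rewrite (independent_time_fubini2 mT G2_measurable TG2 mD).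
rewrite [in RHS]integral_mkcond; apply: eq_integral => w _; rewrite patchE exceedE.
case: ifPn => [|]; rewrite ?inE ?notin_setE => wi.
  by congr (P _); apply/seteqP; split => v /=; [case|].
by rewrite (_ : [set v | _] = set0) ?measure0//; apply/seteqP; split => v //= [].
Qed.

Let p := fine (P (state i)).

Let pE : P (state i) = p%:E.
Proof. by rewrite fineK// fin_num_measure//; exact: measurable_state. Qed.

Let integral_passage y : (\int[P]_(w in state i) (passage y w)%:E =
  (p * passage_transform P X J theta y i)%:E)%E.
Proof.
have le1 : (\int[P]_(w in state i) (passage y w)%:E <= P (state i))%E.
  rewrite -[leRHS]mul1e -integral_cst; last exact: measurable_state.
  apply: ge0_le_lower_integral => w _; first by rewrite lee_fin.
  (* [passage] is at most 1 since it lies below a probability, at any lower level such as y - 1. *)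
  apply: le_trans (@passage_le_exceed y (y - 1) w _) _; first by rewrite ltrBlDr ltrDl.
  exact: probability_le1.
have ge0 : (0 <= \int[P]_(w in state i) (passage y w)%:E)%E.
  by apply: integral_ge0 => w _; rewrite lee_fin.
have Ifin : (\int[P]_(w in state i) (passage y w)%:E)%E \is a fin_num.
  by rewrite ge0_fin_numE// (le_lt_trans le1)// pE ltry.
(* When p = 0 the conditional expectation is a default value, but both sides are 0. *)
have [p0|p0] := eqVneq p 0; last first.
  by rewrite /passage_transform /cond_expectation -/p mulrC divfK// fineK.
by rewrite p0 mul0r; apply/eqP; rewrite eq_le ge0 andbT (le_trans le1)// pE p0.
Qed.

Variables (c psi : 'I_d -> R[i]).
Hypothesis hpsi : forall j, 0 < complex.Re (psi j).
Hypothesis hpassage : forall y : R, 0 < y ->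
  (passage_transform P X J theta y i)%:C = exp_sum psi c y.

Let s y : R := complex.Re (exp_sum psi c y).

Let s_passage y : 0 < y -> passage_transform P X J theta y i = s y.
Proof. by move=> y0; rewrite /s -hpassage. Qed.

Let cs : continuous s.
Proof.
rewrite (_ : s = fun y => complex.Re (1 * exp_sum psi c y)).
  exact: continuous_Re_exp_sum.
by apply/funext => y; rewrite mul1r.
Qed.

(* For y < z, passage z <= exceed y <= passage y, and the continuity of s closes the gap;
   this avoids comparing the events {tau(y) <= T} and {M_T > y}. *)
Let tail_law y : 0 < y ->
  P (MT @^-1` `]y, +oo[ `&` state i) = (p * s y)%:E.
Proof.
move=> y0.
have mexc z : measurable_fun setT (exceed z).
  rewrite exceedE; exact: (measurable_fun_time_ysection P mT G2_measurable).
have le z : 0 < z -> (P (MT @^-1` `]z, +oo[ `&` state i) <= (p * s z)%:E)%E.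
  move=> z0; rewrite exceed_integral -s_passage// -integral_passage.
  by apply: ge0_le_lower_integral => w _; [exact: measure_ge0|exact: exceed_le_passage].
have ge z : y < z -> ((p * s z)%:E <= P (MT @^-1` `]y, +oo[ `&` state i))%E.
  move=> yz; rewrite exceed_integral -s_passage ?(lt_trans y0)// -integral_passage.
  apply: ge0_le_lower_integral => w _; first by rewrite lee_fin.
  exact: passage_le_exceed.
have Pfin : P (MT @^-1` `]y, +oo[ `&` state i) \is a fin_num.
  by rewrite ge0_fin_numE ?(le_lt_trans (le y y0)) ?ltry.
apply/eqP; rewrite eq_le le//= -(fineK Pfin) lee_fin.
apply: (@cvgr_to_le _ y^'+ _ _ (fun z => p * s z)).
  by apply: cvgM; [exact: cvg_cst|exact/cvg_at_right_filter/cs].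
near=> z; rewrite -lee_fin fineK//; apply: ge; near: z; exact: nbhs_right_gt.
Unshelve. all: by end_near. Qed.

(** The integral of [s] over y > x, that is, the mean of (M_T - x)^+ given J_0 = i. *)
Let F x : R := complex.Re (exp_sum psi (fun j => c j / psi j) x).

Let p_ge0 : 0 <= p. Proof. by rewrite fine_ge0. Qed.

Let s_ge0 y : 0 < y -> 0 <= s y.
Proof.
move=> y0; rewrite -s_passage// /passage_transform /cond_expectation divr_ge0//.
by rewrite fine_ge0// integral_ge0// => w _; rewrite lee_fin; exact: passage_ge0.
Qed.

(** [expected_excess] applied in state i, conditional independence supplying its level-by-level
    hypothesis. The weight g serves twice: g = 1 for the integrability of [W], g = |x| for E (Q_0
    W). *)
Lemma expected_idle (g : R -> R) : measurable_fun setT g -> (forall x : R, 0 <= g x) ->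
  (\int[P]_w (\1_(state i) w * g (Q 0 w) * W w)%:E =
   \int[P]_w (\1_(state i) w * g (Q 0 w) * F (Q 0 w))%:E)%E.
Proof.
move=> mg g0.
have mst := measurable_state i (lexx 0).
apply: (@expected_excess _ _ _ P _ _ MT s F) => //.
- apply: measurable_funM; first exact: measurable_indic.
  exact: measurableT_comp.
- exact: continuous_measurable_fun.
- by move=> w; rewrite mulr_ge0.
- move=> x x0; rewrite /F -[X in complex.Re X]mul1r -integral_exp_sum//; last first.
    by move=> y /s_ge0; rewrite mul1r.
  rewrite integral_itv_obnd_cbnd; last first.
    by apply: measurable_funTS; apply/measurable_EFinP; exact: continuous_measurable_fun.
  by apply: eq_integral => y _; rewrite mul1r.
move=> y y0.
have i1 w : \1_[set z | Q 0 z < y] w = \1_(`]-oo, y[%classic) (Q 0 w) :> R.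
  by rewrite !indicE; congr (_%:R); congr nat_of_bool; apply/idP/idP; rewrite !inE/= in_itv.
have i2 w : \1_[set z | y < MT z] w = \1_(`]y, +oo[%classic) (MT w) :> R.
  by rewrite !indicE; congr (_%:R); congr nat_of_bool; apply/idP/idP; rewrite !inE/= in_itv/= andbT.
(* The condition Q_0 < y is absorbed into the function of [Q 0], leaving an event of [MT] alone to
   be separated. *)
pose f x := g x * \1_(`]-oo, y[%classic) x.
pose h x : R := \1_(`]y, +oo[%classic) x.
have mf : measurable_fun setT f by apply: measurable_funM => //; exact: measurable_indic.
have mh : measurable_fun setT h by exact: measurable_indic.
have f0 x : 0 <= f x by rewrite mulr_ge0.
have h0 x : 0 <= h x by [].
have mfQ : measurable_fun setT (fun w => f (Q 0 w)) by exact: measurableT_comp.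
have mhM : measurable_fun setT (fun w => h (MT w)) by exact: measurableT_comp.
transitivity (\int[P]_(w in state i) (f (Q 0 w) * h (MT w))%:E)%E.
  rewrite [in RHS]integral_fin_indic; apply: eq_integral => w _; rewrite i1 i2 /f /h.
  by congr (_%:E); ring.
transitivity (\int[P]_(w in state i) (f (Q 0 w) * s y)%:E)%E; last first.
  rewrite [in LHS]integral_fin_indic; apply: eq_integral => w _; rewrite i1 /f.
  by congr (_%:E); ring.
have [p0|p0] := eqVneq p 0.
  have P0 : P (state i) = 0%E by rewrite pE p0.
  rewrite !(null_set_integral (mu := P) mst _ P0)//.
    by apply: measurable_funTS; apply/measurable_EFinP; exact: measurable_funM.
  by apply: measurable_funTS; apply/measurable_EFinP; exact: measurable_funM.
have indep A B : measurable A -> measurable B ->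
    (P (state i) * P (Q 0 @^-1` A `&` MT @^-1` B `&` state i) =
     P (Q 0 @^-1` A `&` state i) * P (MT @^-1` B `&` state i))%E.
  by move=> mA mB; rewrite MTE; exact: workload_independent_time.
have := conditional_product_integral mst mQ0 mMT indep mf mh f0 h0.
have -> : (\int[P]_(w in state i) (h (MT w))%:E = (p * s y)%:E)%E.
  rewrite -tail_law// -integral_indic//.
  by rewrite -[X in measurable X]setTI; exact: mMT.
rewrite -/(state i) pE => key.
have -> : (\int[P]_(w in state i) (f (Q 0 w) * h (MT w))%:E =
    \int[P]_(w in state i) (f (Q 0 w))%:E * (s y)%:E)%E.
  rewrite -[LHS]mul1e -[1%E]/(1%:E) -(mulVf p0) EFinM -muleA key muleCA -EFinM.
  by rewrite mulrA mulVf// mul1r.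
rewrite -ge0_integralZr//.
- by apply: measurable_funTS; apply/measurable_EFinP.
- by move=> w _; rewrite lee_fin.
- by rewrite lee_fin s_ge0.
Qed.

End fixed_state.

(** * Moments of Q_0 and Q_T *)

Let mW : measurable_fun setT W.
Proof. by apply: measurable_maxr => //; exact: measurable_funB. Qed.

Let W_ge0 w : 0 <= W w. Proof. by rewrite le_max lexx orbT. Qed.

Let QT_decomposition w : QT w = XT w + Q 0 w + W w.
Proof. by rewrite QTE -addrA [Q 0 w + _]addr_maxr addr0 subrKC maxC. Qed.

Hypothesis hvar : ('V_P[Q 0%R] < +oo)%E.

(** The variance centres at m, [fine] of the mean, which is a real number before integrability is
    known; finiteness of E (Q_0 - m)^2 is then enough. *)
Let iQ2 : P.-integrable setT (EFin \o (fun w => Q 0 w ^+ 2)).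
Proof.
have := hvar; rewrite /variance unlock unlock; set m := fine _ => hm.
have mQm : measurable_fun setT (fun w => Q 0 w - m) by exact: measurable_funB.
have i1 : P.-integrable setT (EFin \o (fun w => (Q 0 w - m) ^+ 2)).
  apply/integrableP; split; first by apply/measurable_EFinP; exact: measurable_funX.
  under eq_integral => w _ do rewrite /= ger0_norm ?sqr_ge0//.
  by move: hm; congr (_ < _)%E; apply: eq_integral => w _; rewrite expr2.
have i2 : P.-integrable setT (EFin \o (fun w => 2 * ((Q 0 w - m) ^+ 2 + m ^+ 2))).
  by apply: integrable_finZl; apply: integrable_finD i1 _; exact: integrable_fin_cst.
apply: le_integrable_fin i2; first exact: measurable_funX.
(* 2 ((Q - m)^2 + m^2) - Q^2 = (Q - 2m)^2. *)
by move=> w; rewrite ger0_norm ?sqr_ge0//; have := sqr_ge0 (Q 0 w - 2 * m); nra.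
Qed.

Let iQ : P.-integrable setT (EFin \o Q 0).
Proof.
have i1 : P.-integrable setT (EFin \o (fun w => 1 + Q 0 w ^+ 2)).
  by apply: integrable_finD iQ2; exact: integrable_fin_cst.
apply: le_integrable_fin i1 => // w.
by rewrite ger0_norm ?workload0_ge0//; have := sqr_ge0 (Q 0 w - 1); nra.
Qed.

Let integral_QT (f : R -> R) : measurable_fun setT f -> (forall x, 0 <= f x) ->
  (\int[P]_w (f (QT w))%:E = \int[P]_w (f (Q 0 w))%:E)%E.
Proof.
move=> mf f0.
pose Q0' : {mfun Omega >-> R} := HB.pack (Q 0) (isMeasurableFun.Build _ _ _ _ _ mQ0).
pose QT' : {mfun Omega >-> R} := HB.pack QT (isMeasurableFun.Build _ _ _ _ _ mQT).
have mf' : measurable_fun setT (EFin \o f) by apply/measurable_EFinP.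
have f0' x : (0 <= (EFin \o f) x)%E by rewrite lee_fin.
rewrite -[LHS](@ge0_integral_distribution _ _ _ _ _ P QT' _ mf' f0').
rewrite -[RHS](@ge0_integral_distribution _ _ _ _ _ P Q0' _ mf' f0').
by apply: eq_measure_integral => B mB _; exact: workload_law.
Qed.

Let iQT2 : P.-integrable setT (EFin \o (fun w => QT w ^+ 2)).
Proof.
apply/integrableP; split; first by apply/measurable_EFinP; exact: measurable_funX.
under eq_integral => w _ do rewrite /= ger0_norm ?sqr_ge0//.
rewrite (@integral_QT (fun x => x ^+ 2))//; last by move=> x; exact: sqr_ge0.
have /integrableP[_] := iQ2.
by under eq_integral => w _ do rewrite /= ger0_norm ?sqr_ge0//.
Qed.

Let iQT : P.-integrable setT (EFin \o QT).
Proof.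
have i1 : P.-integrable setT (EFin \o (fun w => 1 + QT w ^+ 2)).
  by apply: integrable_finD iQT2; exact: integrable_fin_cst.
apply: le_integrable_fin i1 => // w.
by rewrite ler_norml; have := sqr_ge0 (QT w - 1); have := sqr_ge0 (QT w + 1); nra.
Qed.

Let mean_QT : \int[P]_w QT w = \int[P]_w Q 0 w.
Proof.
have h := @integral_QT (fun x => `|x|).
have QTn w : QT w = `|QT w| by rewrite ger0_norm// workload_ge0.
have Qn w : Q 0 w = `|Q 0 w| by rewrite ger0_norm// workload0_ge0.
rewrite /Rintegral; under eq_integral do rewrite QTn.
by under [in RHS]eq_integral do rewrite Qn; rewrite h.
Qed.

Let iQQT : P.-integrable setT (EFin \o (fun w => Q 0 w * QT w)).
Proof.
apply: le_integrable_fin (integrable_finD iQ2 iQT2).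
  exact: measurable_funM.
move=> w /=; rewrite ler_norml.
by have := sqr_ge0 (Q 0 w - QT w); have := sqr_ge0 (Q 0 w + QT w); nra.
Qed.

(** * The covariance as a sum over initial states *)

Variables (c : 'I_d -> 'I_d -> R[i]) (psi : 'I_d -> R[i]).
Hypothesis hpsi : forall j, 0 < complex.Re (psi j).
Hypothesis hpassage : forall (y : R) (i : 'I_d), 0 < y ->
  (passage_transform P X J theta y i)%:C = exp_sum psi (c i) y.

Let F i x : R[i] := exp_sum psi (fun j => c i j / psi j) x.

Let F_real i x : 0 <= x -> F i x = (complex.Re (F i x))%:C.
Proof.
move=> x0; apply: (real_exp_sum_primitive hpsi (s := fun y => passage_transform P X J theta y i)) => //.
by move=> y y0; exact: hpassage.
Qed.

Let mF i : measurable_fun setT (fun w => complex.Re (F i (Q 0 w))).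
Proof.
have mFi : measurable_fun setT (fun x => complex.Re (F i x)).
  apply: continuous_measurable_fun.
  rewrite (_ : (fun x => _) = fun x => complex.Re (1 * F i x)).
    exact: continuous_Re_exp_sum.
  by apply/funext => x; rewrite mul1r.
exact: measurableT_comp mFi mQ0.
Qed.

Let integrable_state i (f : Omega -> R) : P.-integrable setT (EFin \o f) ->
  P.-integrable setT (EFin \o (fun w => \1_(state i) w * f w)).
Proof. by move=> i_f; apply: integrable_indicM => //; exact: measurable_state. Qed.

Let sum_state (f : Omega -> R) w : \sum_(i < d) \1_(state i) w * f w = f w.
Proof.
rewrite (bigD1 (J 0 w))//= big1 ?addr0; last first.
  by move=> i iJ; rewrite indicE memNset ?mul0r// /state/= => Ji; rewrite Ji eqxx in iJ.
by rewrite indicE mem_set ?mul1r.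
Qed.

Let Rintegral_states (f : Omega -> R) : P.-integrable setT (EFin \o f) ->
  \int[P]_w f w = \sum_(i < d) \int[P]_w (\1_(state i) w * f w).
Proof.
move=> i_f; rewrite -Rintegral_sum; last by move=> i; exact: integrable_state.
by apply: eq_Rintegral => w _; rewrite sum_state.
Qed.

(** Since [F] is bounded on [0, +oo[, the right side of [expected_idle] is finite; this yields
    integrability on the left and an identity between real integrals. *)
Let idle_state i (g : R -> R) : measurable_fun setT g -> (forall x : R, 0 <= g x) ->
  P.-integrable setT (EFin \o (fun w => g (Q 0 w))) ->
  P.-integrable setT (EFin \o (fun w => \1_(state i) w * (g (Q 0 w) * W w))) /\
  \int[P]_w (\1_(state i) w * (g (Q 0 w) * W w)) =
  \int[P]_w (\1_(state i) w * g (Q 0 w) * complex.Re (F i (Q 0 w))).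
Proof.
move=> mg g0 ig.
have mst : measurable (state i) by exact: measurable_state.
have mgQ : measurable_fun setT (fun w => g (Q 0 w)) by exact: measurableT_comp.
have mi : measurable_fun setT (\1_(state i) : Omega -> R) by exact: measurable_indic.
have key := expected_idle hpsi (fun y y0 => hpassage i y0) mg g0.
have [B hB] := @Re_exp_sum_bounded R d psi hpsi 1 (fun j => c i j / psi j).
have iF : P.-integrable setT (EFin \o (fun w => \1_(state i) w * g (Q 0 w) * complex.Re (F i (Q 0 w)))).
  apply: le_integrable_fin (integrable_finZl B (integrable_state i ig)).
    by apply: measurable_funM; [exact: measurable_funM|exact: mF].
  move=> w; rewrite normrM mulrC; apply: ler_pM => //.
    by have := hB (Q 0 w) (workload0_ge0 w); rewrite mul1r.
  by rewrite ger0_norm// mulr_ge0.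
have E w : \1_(state i) w * (g (Q 0 w) * W w) = \1_(state i) w * g (Q 0 w) * W w.
  by rewrite mulrA.
split; last by rewrite /Rintegral; under eq_integral do rewrite E; rewrite key.
apply/integrableP; split.
  by apply/measurable_EFinP; apply: measurable_funM => //; exact: measurable_funM.
have nn w : 0 <= \1_(state i) w * (g (Q 0 w) * W w) by rewrite !mulr_ge0.
under eq_integral => w _ do rewrite /= ger0_norm// E.
by rewrite key; have := integrable_fin_num measurableT iF; rewrite fin_numElt => /andP[].
Qed.

Let iW : P.-integrable setT (EFin \o W).
Proof.
have i1 i := (@idle_state i (cst 1) (measurable_cst _) (fun=> ler01) (integrable_fin_cst _ _)).1.
have := integrable_sum measurableT (index_enum 'I_d) (P := xpredT) (fun i _ => i1 i).
congr integrable; apply/funext => w; rewrite /= sumEFin; congr EFin.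
by rewrite (sum_state (fun w => 1 * W w)) mul1r.
Qed.

Let iQabs : P.-integrable setT (EFin \o (fun w => `|Q 0 w|)).
Proof. exact: (integrable_abse iQ). Qed.

(** The weights g must be nonnegative on all of R; on the values of [Q 0] the absolute value is the
    identity. *)
Let QabsE w : `|Q 0 w| = Q 0 w. Proof. by rewrite ger0_norm. Qed.

Let mabs : measurable_fun setT (fun x : R => `|x|).
Proof. exact: normr_measurable. Qed.

Let iQW : P.-integrable setT (EFin \o (fun w => Q 0 w * W w)).
Proof.
have i1 i := (@idle_state i (fun x => `|x|) mabs (fun x => normr_ge0 x) iQabs).1.
have := integrable_sum measurableT (index_enum 'I_d) (P := xpredT) (fun i _ => i1 i).
congr integrable; apply/funext => w; rewrite /= sumEFin; congr EFin.
by rewrite (sum_state (fun w => `|Q 0 w| * W w)) QabsE.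
Qed.

Let mean_QW : \int[P]_w (Q 0 w * W w) =
  \sum_(i < d) \int[P]_w (\1_(state i) w * Q 0 w * complex.Re (F i (Q 0 w))).
Proof.
rewrite Rintegral_states//; apply: eq_bigr => i _.
have := (@idle_state i (fun x => `|x|) mabs (fun x => normr_ge0 x) iQabs).2.
under eq_Rintegral do rewrite QabsE.
by under [in X in _ = X -> _]eq_Rintegral do rewrite QabsE.
Qed.

Let iXT : P.-integrable setT (EFin \o XT).
Proof.
have := integrable_finB (integrable_finB iQT iQ) iW.
congr integrable; apply/funext => w /=; congr EFin.
by rewrite QT_decomposition; ring.
Qed.

Let iQXT : P.-integrable setT (EFin \o (fun w => Q 0 w * XT w)).
Proof.
have := integrable_finB (integrable_finB iQQT iQ2) iQW.
congr integrable; apply/funext => w /=; congr EFin.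
by rewrite QT_decomposition; ring.
Qed.

Let integral_state i (f : Omega -> R) : P.-integrable setT (EFin \o f) ->
  (\int[P]_(w in state i) (f w)%:E = (\int[P]_w (\1_(state i) w * f w))%:E)%E.
Proof.
move=> i_f; rewrite integral_fin_indic /Rintegral fineK.
  by apply: eq_integral => w _; rewrite mulrC.
exact: integrable_fin_num (integrable_state i i_f).
Qed.

Let Rintegral_stateB i (f g : Omega -> R) :
  P.-integrable setT (EFin \o f) -> P.-integrable setT (EFin \o g) ->
  \int[P]_w (\1_(state i) w * (f w - g w)) =
  \int[P]_w (\1_(state i) w * f w) - \int[P]_w (\1_(state i) w * g w).
Proof.
move=> i_f ig; rewrite -RintegralB//; try exact: integrable_state.
by apply: eq_Rintegral => w _; rewrite mulrBr.
Qed.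

(** Conditional independence of [Q 0] and [XT]; the factor p it carries cancels the denominator of
    [nu]. *)
Let mean_QXT_state i : \int[P]_w (\1_(state i) w * (Q 0 w * XT w)) =
  nu P X J T i * \int[P]_w (\1_(state i) w * Q 0 w).
Proof.
have mst : measurable (state i) by exact: measurable_state.
rewrite /nu /cond_expectation -/(state i) (integral_state i iXT) /=.
set p := fine (P (state i)).
have pE : P (state i) = p%:E by rewrite fineK// fin_num_measure.
have [p0|p0] := eqVneq p 0.
  have P0 : P (state i) = 0%E by rewrite pE p0.
  (* On a null state [nu] is 0 by the convention on inverses, and the integral over that state is 0
     too. *)
  rewrite p0 invr0 mulr0 mul0r; apply: EFin_inj; rewrite -integral_state//.
  rewrite (null_set_integral (mu := P) mst _ P0)//.
  by apply: measurable_funTS; apply/measurable_EFinP; exact: measurable_funM.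
(* [XT] has no sign and the product formula is for nonnegative functions, so positive and negative
   parts are treated separately. *)
pose g1 (x : R) := Num.max x 0; pose g2 (x : R) := Num.max (- x) 0.
have g10 x : 0 <= g1 x by rewrite le_max lexx orbT.
have g20 x : 0 <= g2 x by rewrite le_max lexx orbT.
have mg1 : measurable_fun setT g1 by exact: measurable_maxr.
have mg2 : measurable_fun setT g2.
  by apply: measurable_maxr => //; exact: oppr_measurable.
have g12 x : x = g1 x - g2 x.
  have /orP[h|h] := le_total 0 x; rewrite /g1 /g2.
    by rewrite max_l// max_r ?oppr_le0// subr0.
  by rewrite max_r// max_l ?oppr_ge0// sub0r opprK.
have g1le x : g1 x <= `|x| by rewrite /g1 ge_max ler_norm normr_ge0.
have g2le x : g2 x <= `|x| by rewrite /g2 ge_max normr_ge0 andbT -normrN ler_norm.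
have indep A B : measurable A -> measurable B ->
    (P (state i) * P (Q 0 @^-1` A `&` XT @^-1` B `&` state i) =
     P (Q 0 @^-1` A `&` state i) * P (XT @^-1` B `&` state i))%E.
  by move=> mA mB; rewrite XTE; exact: workload_independent_time.
have split_g (g : R -> R) : measurable_fun setT g -> (forall x, 0 <= g x) ->
    (forall x, g x <= `|x|) ->
    [/\ P.-integrable setT (EFin \o (fun w => g (XT w))),
        P.-integrable setT (EFin \o (fun w => Q 0 w * g (XT w))) &
        p * \int[P]_w (\1_(state i) w * (Q 0 w * g (XT w))) =
        \int[P]_w (\1_(state i) w * Q 0 w) * \int[P]_w (\1_(state i) w * g (XT w))].
  move=> mg g0 gle.
  have mgX : measurable_fun setT (fun w => g (XT w)) by exact: measurableT_comp.
  have i1 : P.-integrable setT (EFin \o (fun w => g (XT w))).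
    apply: (le_integrable_fin (g := fun w => `|XT w|)) (integrable_abse iXT) => // w.
    by rewrite ger0_norm//; exact: gle.
  have i2 : P.-integrable setT (EFin \o (fun w => Q 0 w * g (XT w))).
    apply: (le_integrable_fin (g := fun w => `|Q 0 w * XT w|)) (integrable_abse iQXT) => [|w].
      exact: measurable_funM.
    by rewrite !normrM ler_wpM2l// ger0_norm//; exact: gle.
  split => //; apply: EFin_inj; rewrite !EFinM -!integral_state// -pE.
  have := conditional_product_integral mst mQ0 mXT indep mabs mg (fun x => normr_ge0 x) g0.
  under eq_integral do rewrite QabsE.
  by under [in X in _ = X -> _]eq_integral do rewrite QabsE.
have [i1 i1Q e1] := split_g _ mg1 g10 g1le.
have [i2 i2Q e2] := split_g _ mg2 g20 g2le.
have -> : \int[P]_w (\1_(state i) w * (Q 0 w * XT w)) =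
    \int[P]_w (\1_(state i) w * (Q 0 w * g1 (XT w) - Q 0 w * g2 (XT w))).
  by apply: eq_Rintegral => w _; rewrite -mulrBr -g12.
have -> : \int[P]_w (\1_(state i) w * XT w) =
    \int[P]_w (\1_(state i) w * (g1 (XT w) - g2 (XT w))).
  by apply: eq_Rintegral => w _; rewrite -g12.
rewrite !Rintegral_stateB//; apply: (mulfI p0).
rewrite mulrBr e1 e2 mulrA [p * _]mulrC divfK//; ring.
Qed.

Let covariance_time : covariance P (Q 0) QT =
  (\int[P]_w (Q 0 w ^+ 2)
   + \sum_(i < d) nu P X J T i * \int[P]_w (\1_(state i) w * Q 0 w)
   + \sum_(i < d) \int[P]_w (\1_(state i) w * Q 0 w * complex.Re (F i (Q 0 w)))
   - (\int[P]_w Q 0 w) ^+ 2)%:E.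
Proof.
rewrite covarianceE; try exact/Lfun1_integrable.
rewrite unlock.
have fin f : P.-integrable setT (EFin \o f) ->
    (\int[P]_w (f w)%:E = (\int[P]_w f w)%:E)%E.
  by move=> i_f; rewrite /Rintegral fineK//; exact: integrable_fin_num.
rewrite !fin// mean_QT -EFinM -EFinB expr2; congr (_ - _)%:E.
rewrite -mean_QW; under [in RHS]eq_bigr do rewrite -mean_QXT_state.
rewrite -Rintegral_states// -RintegralD// -RintegralD//; last exact: integrable_finD.
by apply: eq_Rintegral => w _; rewrite fctE QT_decomposition; ring.
Qed.

(** * Derivatives of the transforms and the final formula *)

(** The derivative is again a transform, with weight [- Q 0], on the whole closed half-plane; the
    same differentiation lemma therefore applies a second time at 0. *)
Let deriv_kappa z : 0 <= complex.Re z -> deriv_half_plane (kappa P Q) z =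
  Cexpectation P (fun w => (- Q 0 w)%:C * Cexp (- z * (Q 0 w)%:C)).
Proof.
move=> z0.
have i1 : P.-integrable setT (EFin \o (fun w => 1 * Q 0 w)) by exact: integrable_finZl.
rewrite (@deriv_half_plane_transform _ _ _ P (fun=> 1) (Q 0))//; last 2 first.
- exact: integrable_fin_cst.
- move=> a _; congr (Cexpectation P _); apply/funext => w.
  by rewrite mul1r.
rewrite transformN//; congr (- Cexpectation P _).
by apply/funext => w; rewrite mul1r.
Qed.

Let deriv_kappa0 : deriv_half_plane (kappa P Q) 0 = - (\int[P]_w Q 0 w)%:C.
Proof.
by rewrite deriv_kappa// transformN// transform0.
Qed.

Let deriv2_kappa0 : deriv_half_plane (deriv_half_plane (kappa P Q)) 0 =
  (\int[P]_w (Q 0 w ^+ 2))%:C.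
Proof.
have iN : P.-integrable setT (EFin \o (fun w => - Q 0 w)).
  have := integrable_finZl (-1) iQ; congr integrable.
  by apply/funext => w /=; rewrite mulN1r.
have iNQ : P.-integrable setT (EFin \o (fun w => - Q 0 w * Q 0 w)).
  have := integrable_finZl (-1) iQ2; congr integrable.
  by apply/funext => w /=; rewrite mulN1r mulNr expr2.
rewrite (@deriv_half_plane_transform _ _ _ P (fun w => - Q 0 w) (Q 0))//; last first.
  exact: measurableT_comp.
rewrite transform0 -[RHS]opprK; congr (- _).
rewrite -[in RHS](mulN1r (_%:C)) (_ : -1 = (-1 : R)%:C) -?rmorphM/=; last by rewrite rmorphN1.
rewrite -RintegralZl//; congr (_%:C); apply: eq_Rintegral => w _.
by rewrite mulN1r mulNr expr2.
Qed.

Let deriv_kappa_state i z : 0 <= complex.Re z ->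
  deriv_half_plane (kappa_state P J Q i) z =
  - Cexpectation P (fun w => (\1_(state i) w * Q 0 w)%:C * Cexp (- z * (Q 0 w)%:C)).
Proof.
move=> z0; have mst : measurable (state i) by exact: measurable_state.
have i1 := integrable_state i (integrable_fin_cst P 1).
rewrite (@deriv_half_plane_transform _ _ _ P (\1_(state i)) (Q 0))//.
- by move: i1; congr integrable; apply/funext => w /=; rewrite mulr1.
- exact: integrable_state.
- move=> a _; congr (Cexpectation P _); apply/funext => w.
  rewrite mulrC indicE; congr (_ * _).
  have [Ji|Ji] := eqVneq (J 0 w) i; first by rewrite mem_set.
  by rewrite memNset//; apply/eqP.
Qed.

(** The sum of exponentials is taken inside the expectation, where it is [F i] at [Q 0]; the
    imaginary part disappears because [F i] is real on [0, +oo[. *)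
Let sum_kappa_state i :
  \sum_(j < d) c i j / psi j * deriv_half_plane (kappa_state P J Q i) (psi j) =
  - (\int[P]_w (\1_(state i) w * Q 0 w * complex.Re (F i (Q 0 w))))%:C.
Proof.
have psi0 j : 0 <= complex.Re (psi j) by exact: ltW.
under eq_bigr => j _ do rewrite deriv_kappa_state// mulrN.
rewrite sumrN; congr (- _); set z := \sum_(j < d) _.
have mV : measurable_fun setT (fun w => \1_(state i) w * Q 0 w).
  by apply: measurable_funM => //; apply: measurable_indic; exact: measurable_state.
have hz k : complex.Re (k * z) =
    \int[P]_w (\1_(state i) w * Q 0 w * complex.Re (k * F i (Q 0 w))).
  by apply: exp_sum_transform => //; exact: integrable_state.
have Rez : complex.Re z = \int[P]_w (\1_(state i) w * Q 0 w * complex.Re (F i (Q 0 w))).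
  by rewrite -[z]mul1r hz; apply: eq_Rintegral => w _; rewrite mul1r.
have Imz : complex.Im z = 0.
  rewrite Im_Re hz; transitivity (\int[P]_(w in setT) (0 : R)); last first.
    by rewrite Rintegral_cst// mul0r.
  apply: eq_Rintegral => w _; rewrite -Im_Re.
  have -> : complex.Im (F i (Q 0 w)) = 0 by rewrite F_real.
  by rewrite mulr0.
by rewrite -Rez; case: z Imz {hz Rez} => x y /= ->.
Qed.

(** Each derivative of kappa_i brings a factor - Q_0, so the two sums subtracted here are the two
    sums added in [covariance_time]. *)
Lemma workload_covariance :
  covariance P (Q 0) (fun w => Q (T w) w) \is a fin_num /\
  (fine (covariance P (Q 0) (fun w => Q (T w) w)))%:C =
    deriv_half_plane (deriv_half_plane (kappa P Q)) 0
    - deriv_half_plane (kappa P Q) 0 ^+ 2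
    - \sum_(i < d) \sum_(j < d)
        c i j / psi j * deriv_half_plane (kappa_state P J Q i) (psi j)
    - \sum_(i < d) (nu P X J T i)%:C * deriv_half_plane (kappa_state P J Q i) 0.
Proof.
rewrite -/QT covariance_time; split => //=.
rewrite deriv2_kappa0 deriv_kappa0.
under [X in _ = _ - X - _]eq_bigr => i _ do rewrite sum_kappa_state.
under [X in _ = _ - _ - X]eq_bigr => i _.
  rewrite deriv_kappa_state// transform0 mulrN -rmorphM/=; over.
rewrite !sumrN !opprK sqrrN -!rmorph_sum -rmorphXn -rmorphB -!rmorphD/=.
by congr (_%:C); ring.
Qed.

End workload.

Theorem theorem3 (R : realType) (dd : measure_display)
    (Omega : measurableType dd) (P : probability Omega R)
    (d : nat) (q : 'M[R]_d) (pi : 'rV[R]_d)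
    (Y : 'I_d -> R -> Omega -> R) (U : 'I_d -> 'I_d -> nat -> Omega -> R)
    (X : R -> Omega -> R) (J : R -> Omega -> 'I_d) (Q : R -> Omega -> R)
    (theta : R) (c : 'I_d -> 'I_d -> R[i]) (psi : 'I_d -> R[i])
    (T : Omega -> R)
    (hirr : irreducible_rates q) (hpi : stationary_distribution q pi)
    (hmap : spectrally_positive_map P Y U X J q)
    (hstab : stability_condition P Y U q pi)
    (hQ : stationary_workload P X J Q)
    (hvar : ('V_P[Q 0%R] < +oo)%E)
    (htheta : 0 < theta)
    (hpsi : forall j, 0 < complex.Re (psi j))
    (hpassage : forall (y : R) (i : 'I_d), 0 < y ->
       (passage_transform P X J theta y i)%:C =
       \sum_(j < d) c i j * Cexp (- psi j * y%:C))
    (hT : exponentially_distributed P theta T)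
    (hTindep : independent_classes P (sigma_var T) (sigma_all Y U X J Q)) :
  covariance P (Q 0) (fun w => Q (T w) w) \is a fin_num /\
  (fine (covariance P (Q 0) (fun w => Q (T w) w)))%:C =
    deriv_half_plane (deriv_half_plane (kappa P Q)) 0
    - deriv_half_plane (kappa P Q) 0 ^+ 2
    - \sum_(i < d) \sum_(j < d)
        c i j / psi j * deriv_half_plane (kappa_state P J Q i) (psi j)
    - \sum_(i < d) (nu P X J T i)%:C * deriv_half_plane (kappa_state P J Q i) 0.
Proof.
apply: (workload_covariance hmap hQ htheta hT hTindep hvar hpsi).
by move=> y i y0; rewrite hpassage.
Qed.
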